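(* Let $R$ be a Henselian valued ring with maximal ideal $\mathfrak{m}$, equipped with the valuation topology. Let $0\le r<n$, let $p=(p_{r+1},\ldots,p_n)$ be an $(n-r)$-tuple of polynomials $p_{r+1},\ldots,p_n\in R[X]$, $X=(X_1,\ldots,X_n)$, and put $$J:=\frac{\partial(p_{r+1},\ldots,p_n)}{\partial(X_{r+1},\ldots,X_n)},\qquad e:=J(\mathbf{0}).$$ Suppose that $$\mathbf{0}\in V:=\{x\in R^n:\ p_{r+1}(x)=\ldots=p_n(x)=0\}.$$ If $e\neq 0$, then there exists a continuous map $$\phi:(e^{2}\cdot\mathfrak{m})^{\times r}\to(e\cdot\mathfrak{m})^{\times(n-r)}$$ such that $\phi(0)=0$ and the graph map $$(e^{2}\cdot\mathfrak{m})^{\times r}\ni u\mapsto(u,\phi(u))\in(e^{2}\cdot\mathfrak{m})^{\times r}\times(e\cdot\mathfrak{m})^{\times(n-r)}$$ is an open embedding into the zero locus $V$ of the polynomials $p$.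
   Context: For a set $S$, $S^{\times k}$ is its $k$-fold Cartesian product; for $c\in R$, $c\cdot\mathfrak{m}=\{cx:x\in\mathfrak{m}\}$. $\mathbf{0}=(0,\ldots,0)\in R^n$. $\frac{\partial(p_{r+1},\ldots,p_n)}{\partial(X_{r+1},\ldots,X_n)}$ denotes the Jacobian determinant $\det\left[\partial p_i/\partial X_j\right]_{i,j=r+1}^n$. A Henselian valued ring is a valuation ring (of a valuation of arbitrary rank on its fraction field) that is a Henselian local ring; the valuation topology is the topology induced by this valuation, and $R^n$ and its subsets (in particular $V$) carry the product and subspace topologies. An open embedding into $V$ is a homeomorphism onto an open subset of $V$. *)

(* Defs.v *)
From HB Require Import structures.
From mathcomp Require Import all_boot all_order all_algebra.
From mathcomp Require Import all_classical topology.
(* The notations of mpoly and of the topology library cannot be loaded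
   together; canonical instances and coercions of both are needed. *)
From mathcomp.multinomials Require Import -(notations) mpoly.

Set Implicit Arguments.
Unset Strict Implicit.
Unset Printing Implicit Defensive.

Import Order.TTheory GRing.Theory Num.Theory.
Local Open Scope classical_set_scope.
Local Open Scope ring_scope.

Notation "{ 'mpoly' R [ n ] }" := (mpoly n R)
  (at level 0, R at level 2, format "{ 'mpoly'  R [ n ] }") : type_scope.

#[short(type="topIdomainType")]
HB.structure Definition TopIdomain :=
  {R of GRing.IntegralDomain R & Topological R}.

Record ordered_group (G : porderZmodType) : Prop := OrderedGroup {
  og_total : total (<=%R : rel G);
  og_leD : forall x y z : G, x <= y -> z + x <= z + y }.

(* A valuation on K with value group exactly G.  Only the values of v on
   nonzero elements matter: v 0 stands for infinity and is never used. *)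
Record valuation (K : fieldType) (G : porderZmodType) (v : K -> G) : Prop :=
  Valuation {
  val_group : ordered_group G;
  valM : forall x y, x != 0 -> y != 0 -> v (x * y) = v x + v y;
  valD : forall x y, x != 0 -> y != 0 -> x + y != 0 ->
    Order.min (v x) (v y) <= v (x + y);
  val_surj : forall g, exists2 x, x != 0 & v x = g }.

(* The nonunits: an ideal, the maximal one, exactly when R is local. *)
Definition max_ideal (R : idomainType) : set R :=
  [set x | x \isn't a GRing.unit].

Definition local_ring (R : idomainType) : Prop :=
  forall x y : R, max_ideal x -> max_ideal y -> max_ideal (x + y).

(* Simple roots in the residue field, given by a representative a,
   lift to roots in R. *)
Definition henselian (R : idomainType) : Prop :=
  local_ring R /\
  forall (f : {poly R}) (a : R), f \is monic ->
    max_ideal f.[a] -> ~ max_ideal f^`().[a] ->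
    exists b, f.[b] = 0 /\ max_ideal (b - a).

(* R is the ring {x | v x >= 0} of the valuation v on its fraction field. *)
Definition valuation_ring (R : idomainType) (G : porderZmodType)
    (v : {fraction R} -> G) : Prop :=
  valuation v /\
  forall x : {fraction R},
    (exists a : R, x = tofrac a) <-> (x = 0 \/ 0 <= v x).

(* Basic neighborhoods {b | v (b - a) > g}, for g in the value group, with
   v 0 = infinity; in particular a trivial v gives the discrete topology. *)
Definition valuation_topology (R : topIdomainType) (G : porderZmodType)
    (v : {fraction R} -> G) : Prop :=
  forall (a : R) (U : set R), nbhs a U <->
    exists g : G,
      [set b : R | b = a \/ g < v (tofrac (b - a))] `<=` U.

Record henselian_valued_ring (R : topIdomainType) (G : porderZmodType)
    (v : {fraction R} -> G) : Prop := HenselianValuedRing {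
  hvr_valuation : valuation_ring v;
  hvr_henselian : henselian R;
  hvr_topology : valuation_topology v }.

Definition homeomorphism (X Y : topologicalType) (f : X -> Y) : Prop :=
  exists g : Y -> X, [/\ continuous f, continuous g, cancel f g & cancel g f].

Definition open_embedding (X Y : topologicalType) (f : X -> Y) : Prop :=
  exists2 W : set Y, open W &
  exists h : X -> W, homeomorphism h /\ forall x, set_val (h x) = f x.

(* (c m)^k as a set of row vectors, where c m = {c y : y in m}. *)
Definition cm_pow (R : idomainType) (c : R) (k : nat) : set 'rV[R]_k :=
  [set x | forall i, [set c * y | y in @max_ideal R] (x 0 i)].

Arguments cm_pow {R} c k.

(* Polynomials in n = r + k variables: lshift k i (i < r) indexes the first r
   variables, rshift r j (j < k) the last k = n - r ones, and the k
   polynomials are indexed by 'I_k. *)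
Section zero_locus.
Variables (R : idomainType) (r k : nat).
Implicit Types p : 'I_k -> {mpoly R[r + k]}.

Definition zero_locus p : set 'rV[R]_(r + k) :=
  [set x | forall i, meval (x 0) (p i) = 0].

Definition jacobian p : {mpoly R[r + k]} :=
  \det (\matrix_(i < k, j < k)
         mderiv (rshift r j) (p i) : 'M[{mpoly R[r + k]}]_k).
End zero_locus.

(* Main.v *)
Require Import Defs.
From HB Require Import structures.
From mathcomp Require Import all_boot all_order all_algebra.
From mathcomp Require Import generic_quotient ring_quotient.
From mathcomp Require Import ring zify.
From mathcomp Require Import all_classical topology.
From mathcomp.multinomials Require Import -(notations) mpoly.

Set Implicit Arguments.
Unset Strict Implicit.
Unset Printing Implicit Defensive.

Import Order.TTheory GRing.Theory Num.Theory.
Local Open Scope classical_set_scope.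
Local Open Scope ring_scope.

(** The map phi solves p(u, y) = 0 for y.  Let J be the Jacobian matrix at the
    origin, and substitute u = e^2 u' and y = e adj(J) w.  Since J adj(J) = e,
    the linear part of p in w becomes e^2 w and everything else is divisible by
    e^2 as well; dividing leaves an equation w = G(w) in which G(0) and the
    first derivatives of G at 0 lie in the maximal ideal m
    (jacobian_rescaling).  It has a solution in m^k by the multivariate Hensel
    lemma (multivariate_hensel).  Comparing two points (u, y) and (u', y') of V
    in the box gives e (y - y') = Q (u - u') with a matrix Q over R
    (implicit_function_lipschitz).  Hence y is determined by u, so that the
    graph of phi is the intersection of V with the open box, and phi is
    continuous.

    Most of the work is to derive the multivariate Hensel lemma from the
    lifting of simple roots of polynomials in one variable.  As the value group
    is arbitrary, Newton iteration need not converge.  Instead, let D be the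
    ring of germs at the origin of the scheme X = G(X), modulo its R-torsion
    (fixpoint_germs), and let z be the class of X in D^k.  The aim is to show
    that all z_i come from R.

    First, R embeds in D (fixpoint_torsion_free).  Only finitely many
    coefficients are involved, so this happens over a finitely generated
    subring of R.  Such a ring is noetherian by Hilbert's basis theorem, Newton
    iteration works modulo every power of the ideal generated by the small
    coefficients, and these powers meet in zero by Krull's theorem.

    Second, every z_i is algebraic over R (nonsingular_zero_algebraic).  The
    k + 1 polynomials X - G and X_i in k variables are algebraically dependent.
    Restricting the relation to a formal curve through z, along which the k
    polynomials X - G vanish to widely different orders, isolates a nonzero
    polynomial in X_i alone.  Over a valuation ring it can be divided by its
    content, hence be assumed to have a unit coefficient.

    Third, such a relation a_0 + a_1 z_i + ... = 0 with a_j a unit provides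
    s = a_j + a_(j+1) z_i + ..., a unit at the origin for which s and s z_i
    preserve the span of bounded powers of z_i (truncation_bounded).  Writing
    G(X) = G(0) + N X, the determinant g of 1 - N is a unit at the origin as
    well, and g z_i lies in m D for all i.  Therefore some product of g and a power of the s acts on the finite
    module W spanned by bounded monomials in z, and modulo m its matrix there
    has one nonzero row, with a unit on the diagonal.  The characteristic
    polynomial is (T - r) T^N modulo m, its simple root r lifts to a scalar b in
    R, and the product equals b (henselian_scalar).  The matrix equation then
    expresses W, and in particular the z_i, by scalars (rational_point). *)

(** * Ideals, subrings and quotients *)

(** Ideals and subrings are propositional predicates because those used below
    are defined by unbounded existential quantification. *)
Record is_ideal (A : comNzRingType) (I : A -> Prop) : Prop := IsIdeal {
  ideal0 : I 0;
  idealD : forall x y, I x -> I y -> I (x + y);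
  idealM : forall a x, I x -> I (a * x) }.

Record is_subring (A : comNzRingType) (S : A -> Prop) : Prop := IsSubring {
  subring1 : S 1;
  subringB : forall x y, S x -> S y -> S (x - y);
  subringM : forall x y, S x -> S y -> S (x * y) }.

Section ideal_theory.
Variables (A : comNzRingType) (I : A -> Prop).
Hypothesis idI : is_ideal I.

Lemma idealMr a x : I x -> I (x * a).
Proof. by rewrite mulrC; apply: (idealM idI). Qed.

Lemma idealN x : I x -> I (- x).
Proof. by rewrite -mulN1r; apply: (idealM idI). Qed.

Lemma idealB x y : I x -> I y -> I (x - y).
Proof. by move=> Ix Iy; apply: (idealD idI) => //; apply: idealN. Qed.

Lemma ideal_sum (J : Type) (r : seq J) (P : pred J) (f : J -> A) :
  (forall j, P j -> I (f j)) -> I (\sum_(j <- r | P j) f j).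
Proof. by move=> If; apply: big_ind => //; [apply: (ideal0 idI)|apply: (idealD idI)]. Qed.

Definition ideal_mem : pred A := fun x => `[<I x>].

Fact ideal_mem_closed : ~ I 1 -> idealr_closed ideal_mem.
Proof.
move=> I1; split; rewrite ?unfold_in.
- exact/asboolP/(ideal0 idI).
- exact/asboolPn.
- move=> a x y /asboolP Ix /asboolP Iy; apply/asboolP.
  by apply: (idealD idI) => //; apply: (idealM idI).
Qed.
End ideal_theory.

Lemma ideal_quotient (A : comNzRingType) (I : A -> Prop) :
  is_ideal I -> ~ I 1 ->
  exists (Q : comNzRingType) (f : {rmorphism A -> Q}),
    (forall q, exists a, f a = q) /\ (forall a, f a = 0 <-> I a).
Proof.
move=> idI I1.
pose cl := ideal_mem_closed idI I1.
pose J : idealr A := HB.pack (ideal_mem I) (isIdealr.Build A (ideal_mem I) cl).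
pose Q : comNzRingType := {ideal_quot J}.
exists Q, (\pi_Q%qT : {rmorphism A -> {ideal_quot J}}); split.
  by move=> q; exists (repr (q : {ideal_quot J})); exact: reprK.
move=> a; have -> : I a <-> a - 0 \in J by rewrite subr0; split => /asboolP.
rewrite Quotient.idealrBE -[RHS](rmorph0 (\pi_Q%qT : {rmorphism A -> {ideal_quot J}})).
by split => /eqP.
Qed.

Lemma subring0 (A : comNzRingType) (S : A -> Prop) : is_subring S -> S 0.
Proof. by move=> sS; rewrite -(subrr 1); apply: (subringB sS); apply: (subring1 sS). Qed.

Lemma subringN (A : comNzRingType) (S : A -> Prop) x :
  is_subring S -> S x -> S (- x).
Proof. by move=> sS Sx; rewrite -sub0r; apply: (subringB sS) => //; apply: subring0. Qed.

Lemma subringD (A : comNzRingType) (S : A -> Prop) x y :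
  is_subring S -> S x -> S y -> S (x + y).
Proof. by move=> sS Sx Sy; rewrite -[y]opprK; apply: (subringB sS) => //; apply: subringN. Qed.

Lemma subring_sum (A : comNzRingType) (S : A -> Prop) (J : Type) (r : seq J)
    (P : pred J) (f : J -> A) :
  is_subring S -> (forall j, P j -> S (f j)) -> S (\sum_(j <- r | P j) f j).
Proof.
by move=> sS Sf; apply: big_ind => // [|x y]; [apply: subring0|apply: subringD].
Qed.

(** * Hilbert's basis theorem *)

(** A form of the ascending chain condition that does not mention ideals. *)
Definition noetherian (T : comNzRingType) : Prop := forall f : nat -> T,
  exists n (r : nat -> T), f n = \sum_(i < n) r i * f i.

Lemma noetherian_int : noetherian int.
Proof.
move=> f; have [f0|] := pselect (f 0%N = 0).
  by exists 0%N, f; rewrite big_ord0.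
move=> f0.
pose comb n x := exists r : nat -> int, x = \sum_(i < n) r i * f i.
have combS n x : comb n x -> comb n.+1 x.
  case=> r ->; exists (fun i => if (i < n)%N then r i else 0).
  rewrite big_ord_recr /= ltnn mul0r addr0.
  by apply: eq_bigr => i _; rewrite ltn_ord.
pose P m := `[< (0 < m)%N /\ exists n, comb n (Posz m) >].
have exP : exists m, P m.
  exists `|f 0%N|%N; apply/asboolP; split; first by rewrite absz_gt0; apply/eqP.
  exists 1%N, (fun=> sgz (f 0%N)).
  by rewrite big_ord1 -abszEsg.
case: (ex_minnP exP) => m /asboolP[m_gt0 [n [r mE]]] m_min.
exists n, (fun i => (f n %/ m)%Z * r i).
under eq_bigr do rewrite -mulrA.
rewrite -mulr_sumr -mE.
suff mod0 : (f n %% m)%Z = 0 by rewrite {1}(divz_eq (f n) m) mod0 addr0.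
apply/eqP; apply/negPn/negP => mod_neq0.
have mod_ge0 : 0 <= (f n %% m)%Z by rewrite modz_ge0 // eqz_nat -lt0n.
have : (m <= `|(f n %% m)%Z|)%N.
  apply: m_min; apply/asboolP; split; first by rewrite absz_gt0.
  exists n.+1, (fun i => if (i < n)%N then - (f n %/ m)%Z * r i else 1).
  rewrite big_ord_recr /= ltnn mul1r gez0_abs //.
  under eq_bigr do rewrite ltn_ord -mulrA.
  by rewrite -mulr_sumr -mE mulNr addrC {2}(divz_eq (f n) m) addrAC subrr add0r.
by rewrite leqNgt -ltz_nat gez0_abs // ltz_pmod.
Qed.

Section hilbert_basis.
Variable T : comNzRingType.
Hypothesis noethT : noetherian T.
Implicit Types (s : seq {poly T}) (f : nat -> {poly T}).

Let span s (q : {poly T}) := exists r : nat -> {poly T}, q = \sum_(i < size s) r i * s`_i.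

Let span_ideal s : is_ideal (span s).
Proof.
split=> [|_ _ [r ->] [r' ->]|a _ [r ->]].
- by exists (fun=> 0); rewrite big1 // => i _; rewrite mul0r.
- exists (fun i => r i + r' i); rewrite -big_split /=.
  by apply: eq_bigr => i _; rewrite mulrDl.
- exists (fun i => a * r i); rewrite mulr_sumr.
  by apply: eq_bigr => i _; rewrite mulrA.
Qed.

Let span_mem s q : q \in s -> span s q.
Proof.
move=> qs; exists (fun i => (i == index q s)%:R).
have lt_qs : (index q s < size s)%N by rewrite index_mem.
rewrite (bigD1 (Ordinal lt_qs)) //= eqxx mul1r nth_index // big1 ?addr0 //.
by move=> i; rewrite -val_eqE /= => /negPf ->; rewrite mul0r.
Qed.

Let span_sub (I : {poly T} -> Prop) s q :
  is_ideal I -> (forall x, x \in s -> I x) -> span s q -> I q.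
Proof.
move=> idI sI [r ->]; apply: ideal_sum => // i _; apply: (idealM idI).
by apply/sI/mem_nth.
Qed.

Lemma noetherian_poly : noetherian {poly T}.
Proof.
move=> f; apply: contrapT => no_comb.
have {no_comb} fN n : ~ span (mkseq f n) (f n).
  case=> r fE; apply: no_comb; exists n, r; rewrite fE size_mkseq.
  by apply: eq_bigr => i _; rewrite nth_mkseq.
pose I (q : {poly T}) := exists n, span (mkseq f n) q.
have span_le m n q : (m <= n)%N -> span (mkseq f m) q -> span (mkseq f n) q.
  move=> le_mn; apply: span_sub; first exact: span_ideal.
  move=> _ /mapP[i + ->]; rewrite mem_iota add0n => lt_im.
  by apply/span_mem/map_f; rewrite mem_iota (leq_trans lt_im).
have idI : is_ideal I.
  split=> [|x y [m mx] [n ny]|a x [m mx]].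
  - by exists 0%N; apply: (ideal0 (span_ideal _)).
  - exists (maxn m n); apply: (idealD (span_ideal _)).
      by apply: span_le mx; exact: leq_maxl.
    by apply: span_le ny; exact: leq_maxr.
  - by exists m; apply: (idealM (span_ideal _)).
have fI n : I (f n).
  by exists n.+1; apply/span_mem/map_f; rewrite mem_iota add0n ltnSn.
pose new s (q : {poly T}) := I q /\ ~ span s q.
have newP s : (forall x, x \in s -> I x) -> exists q, new s q.
  move=> sI; suff [N sN] : exists N, forall x, x \in s -> span (mkseq f N) x.
    exists (f N); split=> // fNs; apply: (fN N).
    by apply: span_sub fNs => //; exact: span_ideal.
  elim: s sI => [|x s IHs] sI; first by exists 0%N.
  have [|N sN] := IHs; first by move=> y ys; apply: sI; rewrite inE ys orbT.
  have [M xM] : I x by apply: sI; rewrite inE eqxx.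
  exists (maxn M N) => y; rewrite inE => /predU1P[->|/sN].
    by apply: span_le xM; exact: leq_maxl.
  by apply: span_le; exact: leq_maxr.
(* The classical proof: keep adjoining an element of least degree outside the
   ideal generated so far. *)
have /choice[next nextP] : forall s, exists q : {poly T}, (exists p, new s p) ->
    new s q /\ forall p, new s p -> (size q <= size p)%N.
  move=> s; have [[p0 ps]|nos] := pselect (exists p, new s p); last by exists 0.
  pose P m := `[< exists2 p, new s p & size p = m >].
  have exP : exists m, P m by exists (size p0); apply/asboolP; exists p0.
  case: (ex_minnP exP) => _ /asboolP[q qs <-] q_min.
  exists q => _; split=> // p ps'; apply: q_min.
  by apply/asboolP; exists p.
pose gs n := iter n (fun s => rcons s (next s)) [::].
pose g n : {poly T} := next (gs n).
have gsE n : gs n = mkseq g n.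
  by elim: n => // n IHn; rewrite mkseqS -IHn.
have gsI n x : x \in gs n -> I x.
  elim: n x => //= n IHn x; rewrite mem_rcons inE => /predU1P[->|]; last exact: IHn.
  by case: (nextP _ (newP _ IHn)) => [[]].
have gP n := nextP _ (newP _ (@gsI n)).
have size_g i n : (i <= n)%N -> (size (g i) <= size (g n))%N.
  move=> le_in; apply: (gP i).2; case: (gP n) => [[Ign gn] _]; split=> // gni.
  apply: gn; apply: span_sub gni; first exact: span_ideal.
  rewrite !gsE => _ /mapP[j + ->]; rewrite mem_iota add0n => lt_ji.
  by apply/span_mem/map_f; rewrite mem_iota (leq_trans lt_ji).
have [n [r aE]] := noethT (fun n => lead_coef (g n)).
have [[Ig gN] g_min] := gP n.
(* Subtracting h cancels the leading term of g n, against minimality. *)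
pose h : {poly T} := \sum_(i < n) (r i *: 'X^(size (g n) - size (g i))) * g i.
have hs : span (gs n) h.
  apply: ideal_sum => [|i _]; first exact: span_ideal.
  apply: (idealM (span_ideal _)); apply: span_mem.
  by rewrite gsE; apply/map_f; rewrite mem_iota /=.
have : (size (g n) <= size (g n - h)%R)%N.
  apply: g_min; split.
    apply: idealB => //; apply: span_sub hs => // x; exact: gsI.
  move=> gh; apply: gN; rewrite -[next _](subrK h).
  exact: (idealD (span_ideal _)).
have gn_gt0 : (0 < size (g n))%N.
  rewrite lt0n size_poly_eq0; apply/eqP => g0; apply: gN; rewrite -/(g n) g0.
  exact: (ideal0 (span_ideal _)).
apply/negP; rewrite -ltnNge -(prednK gn_gt0) ltnS.
apply/leq_sizeP => j le_j; rewrite coefB /h coef_sum.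
have le_gi (i : 'I_n) : (size (g i) <= size (g n))%N by apply/size_g/ltnW.
have gi_gt0 (i : 'I_n) : (0 < size (g i))%N.
  rewrite lt0n size_poly_eq0; apply/eqP => g0; have [[_ +] _] := gP i; apply.
  by rewrite -/(g i) g0; apply: (ideal0 (span_ideal _)).
rewrite (eq_bigr (fun i : 'I_n => r i * (g i)`_(j - (size (g n) - size (g i)))));
  last first.
  move=> i _; rewrite -scalerAl coefZ coefXnM ltnNge.
  rewrite (leq_trans _ le_j) //; move: (gi_gt0 i) (le_gi i).
  by case: (size (g i)) => // a _; case: (size (g n)) => // b; rewrite subSS leq_subr.
move: le_j; rewrite leq_eqVlt => /predU1P[<-|lt_j].
  rewrite -/(lead_coef (g n)) aE -sumrB big1 // => i _.
  suff -> : ((size (g n)).-1 - (size (g n) - size (g i)) = (size (g i)).-1)%N.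
    by rewrite subrr.
  move: (gi_gt0 i) (le_gi i); case: (size (g i)) => // a _.
  by case: (size (g n)) => // b; rewrite subSS ltnS /= => /subKn.
have le_gj : (size (g n) <= j)%N by rewrite -(prednK gn_gt0).
rewrite nth_default // big1 ?subrr // => i _; rewrite nth_default ?mulr0 //.
rewrite leq_subRL; last by rewrite (leq_trans _ le_gj) ?leq_subr.
by rewrite subnK.
Qed.
End hilbert_basis.

(** * Finitely generated subrings *)

Definition generated (A : comNzRingType) (s : seq A) (x : A) : Prop :=
  forall S : A -> Prop, is_subring S -> (forall a, a \in s -> S a) -> S x.

Lemma generated_subring (A : comNzRingType) (s : seq A) : is_subring (generated s).
Proof.
split=> [|x y gx gy|x y gx gy] S sS sub.
- exact: (subring1 sS).
- by apply: (subringB sS); [apply: gx|apply: gy].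
- by apply: (subringM sS); [apply: gx|apply: gy].
Qed.

Lemma generated_mem (A : comNzRingType) (s : seq A) a : a \in s -> generated s a.
Proof. by move=> sa S _; apply. Qed.

(** Every finitely generated subring is a quotient of an iterated polynomial
    ring over the integers. *)
Lemma generated_image (A : comNzRingType) (s : seq A) :
  exists (T : comNzRingType) (f : {rmorphism T -> A}),
    noetherian T /\ forall a, generated s a <-> exists t, f t = a.
Proof.
suff [T [f [nT [fs sf]]]] : exists (T : comNzRingType) (f : {rmorphism T -> A}),
    noetherian T /\ (forall t, generated s (f t)) /\
    (forall a, a \in s -> exists t, f t = a).
  exists T, f; split=> // a; split=> [sa|[t <-]]; last exact: fs.
  apply: (sa (fun b => exists t, f t = b)) => //; split=> [|_ _ [x <-] [y <-]|_ _ [x <-] [y <-]].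
  - by exists 1; rewrite rmorph1.
  - by exists (x - y); rewrite rmorphB.
  - by exists (x * y); rewrite rmorphM.
elim: s => [|a s [T [f [nT [fs sf]]]]].
  exists int, (intmul 1 : {rmorphism int -> A}); split; first exact: noetherian_int.
  split=> // t; have sg := generated_subring (A := A) [::].
  elim/int_ind: t => [|n IHn|n IHn] /=.
  - by rewrite mulr0z; apply: (subring0 sg).
  - rewrite -addn1 PoszD rmorphD /= mulr1z.
    exact: (subringD sg IHn (subring1 sg)).
  - rewrite -addn1 PoszD opprD rmorphD /= mulrN1z.
    exact: (subringB sg IHn (subring1 sg)).
have cfa : commr_rmorph f a by move=> x; apply: mulrC.
exists {poly T}, (horner_morph cfa : {rmorphism {poly T} -> A}).
split; first exact: noetherian_poly.
have sg := generated_subring (a :: s); split.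
  move=> p; rewrite /= /horner_morph horner_coef; apply: subring_sum => // i _.
  apply: (subringM sg).
    rewrite coef_map => S sS sub; apply: fs => // x xs; apply: sub.
    by rewrite inE xs orbT.
  elim: (i : nat) => [|n IHn]; first by rewrite expr0; apply: (subring1 sg).
  by rewrite exprS; apply: (subringM sg) => //; apply: generated_mem; rewrite inE eqxx.
move=> x; rewrite inE => /predU1P[->|/sf[t <-]].
  by exists 'X; rewrite /= horner_morphX.
by exists t%:P; rewrite /= horner_morphC.
Qed.

Lemma generated_noetherian (A : comNzRingType) (s : seq A) (f : nat -> A) :
  (forall n, generated s (f n)) ->
  exists n (r : nat -> A),
    (forall i, generated s (r i)) /\ f n = \sum_(i < n) r i * f i.
Proof.
move=> fs; have [T [h [nT hP]]] := generated_image s.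
have /choice[t tE] : forall n, exists t, h t = f n by move=> n; apply/hP.
have [n [r rE]] := nT t.
exists n, (h \o r); split=> [i|]; first by apply/hP; exists (r i).
by rewrite -tE rE rmorph_sum; apply: eq_bigr => i _; rewrite rmorphM /= tE.
Qed.

(** * Taylor expansion of multivariate polynomials *)

Local Notation mvar i := (mpolyX _ (mnm1 i)).

Lemma mpoly_ring_ind (A : comNzRingType) n (S : A -> Prop) (P : mpoly n A -> Prop) :
  is_subring S ->
  (forall c, S c -> P (mpolyC n c)) -> (forall i, P (mvar i)) ->
  (forall p q, P p -> P q -> P (p + q)) ->
  (forall p q, P p -> P q -> P (p * q)) ->
  forall p, (forall m, S (mcoeff m p)) -> P p.
Proof.
move=> sS PC PX PD PM p pS; rewrite (mpolyE p).
apply: big_ind => //; first by rewrite -(mpolyC0 n); apply/PC/(subring0 sS).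
move=> m _; rewrite -mul_mpolyC; apply: (PM); first exact: PC.
rewrite mpolyXE_id; apply: big_ind => [|x y|i _].
- by rewrite -(mpolyC1 n); apply/PC/(subring1 sS).
- exact: (PM).
elim: (m i) => [|d IHd].
  by rewrite expr0 -(mpolyC1 n); apply/PC/(subring1 sS).
by rewrite exprS; apply: PM.
Qed.

Lemma subringT (A : comNzRingType) : is_subring (fun _ : A => True).
Proof. by split. Qed.

Lemma mpoly_ind (A : comNzRingType) n (P : mpoly n A -> Prop) :
  (forall c, P (mpolyC n c)) -> (forall i, P (mvar i)) ->
  (forall p q, P p -> P q -> P (p + q)) ->
  (forall p q, P p -> P q -> P (p * q)) -> forall p, P p.
Proof.
move=> PC PX PD PM p.
by apply: (@mpoly_ring_ind A n (fun=> True) P (subringT A) (fun c _ => PC c)).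
Qed.

Lemma rmorph_mmap (A B C : comNzRingType) n (f : {rmorphism A -> B})
    (phi : {rmorphism B -> C}) (g : {rmorphism A -> C})
    (a : 'I_n -> B) (b : 'I_n -> C) (p : mpoly n A) :
  (forall c, phi (f c) = g c) -> (forall i, phi (a i) = b i) ->
  phi (mmap f a p) = mmap g b p.
Proof.
move=> fg ab; rewrite /mmap rmorph_sum; apply: eq_bigr => m _.
rewrite rmorphM fg /mmap1 rmorph_prod; congr (_ * _).
by apply: eq_bigr => i _; rewrite rmorphXn ab.
Qed.

Lemma eq_mmap (A B : comNzRingType) n (f : {rmorphism A -> B}) (a b : 'I_n -> B)
    (p : mpoly n A) : a =1 b -> mmap f a p = mmap f b p.
Proof. by move=> ab; apply: (rmorph_mmap (phi := idfun)). Qed.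

Lemma mderiv_var (A : comNzRingType) n (i j : 'I_n) :
  mderiv j (mvar i) = mpolyC n (i == j)%:R :> mpoly n A.
Proof.
rewrite mderivX mnm1E; case: eqVneq => [->|_] /=; last by rewrite scale0r mpolyC0.
suff -> : mnm_sub (mnm1 j) (mnm1 j) = @mnm0 n by rewrite mpolyX0 scale1r mpolyC1.
by apply/mnmP => l; rewrite mnmBE mnm0E subnn.
Qed.

Lemma mmap_var (A B : comNzRingType) n (f : {rmorphism A -> B}) (a : 'I_n -> B) i :
  mmap f a (mvar i) = a i.
Proof. by rewrite mmapX mmap1U. Qed.

Lemma mmap_const (A B : comNzRingType) n (f : {rmorphism A -> B}) (a : 'I_n -> B) c :
  mmap f a (mpolyC n c) = f c.
Proof. exact: mmapC. Qed.

Lemma mmapM (A B : comNzRingType) n (f : {rmorphism A -> B}) (a : 'I_n -> B) p q :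
  mmap f a (p * q) = mmap f a p * mmap f a q.
Proof. exact: rmorphM. Qed.

Lemma coef_mderiv (A : comNzRingType) n (S : A -> Prop) (p : mpoly n A) l :
  is_subring S -> (forall m, S (mcoeff m p)) -> forall m, S (mcoeff m (mderiv l p)).
Proof.
move=> sS pS m; rewrite mcoeff_mderiv -mulr_natr; apply: (subringM sS) => //.
elim: (m l).+1 => [|d IHd]; first exact: subring0.
by rewrite -addn1 natrD; apply: subringD => //; apply: (subring1 sS).
Qed.

Section taylor.
Variables (A B : comNzRingType) (f : {rmorphism A -> B}) (n : nat).
Variables (S : B -> Prop) (a h : 'I_n -> B).
Hypotheses (sS : is_subring S) (Sa : forall i, S (a i)) (Sh : forall i, S (h i)).

Lemma mmap_closed p : (forall m, S (f (mcoeff m p))) -> S (mmap f a p).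
Proof.
have sf : is_subring (S \o f).
  by split=> [|x y|x y] /=; rewrite (rmorph1, rmorphB, rmorphM);
    [apply: (subring1 sS)|apply: (subringB sS)|apply: (subringM sS)].
apply: (@mpoly_ring_ind A n _ (fun p => S (mmap f a p)) sf) => [c Sc|i|p' q|p' q].
- by rewrite mmap_const.
- by rewrite mmap_var.
- by rewrite mmapD; apply: subringD.
- by rewrite rmorphM; apply: (subringM sS).
Qed.
End taylor.

(** The remainder is tracked inside an arbitrary subring S so that the
    expansion can be used over a finitely generated subring. *)
Lemma taylor (A B : comNzRingType) (f : {rmorphism A -> B}) n (S : B -> Prop)
    (a h : 'I_n -> B) (p : mpoly n A) :
  is_subring S -> (forall i, S (a i)) -> (forall i, S (h i)) ->
  (forall m, S (f (mcoeff m p))) ->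
  exists s : 'I_n -> 'I_n -> B, (forall i j, S (s i j)) /\
    mmap f (fun i => a i + h i) p =
    mmap f a p + \sum_i h i * mmap f a (mderiv i p)
               + \sum_i \sum_j h i * h j * s i j.
Proof.
move=> sS Sa Sh.
have sf : is_subring (S \o f).
  by split=> [|x y|x y] /=; rewrite (rmorph1, rmorphB, rmorphM);
    [apply: (subring1 sS)|apply: (subringB sS)|apply: (subringM sS)].
pose b i := a i + h i.
have Sb i : S (b i) by apply: subringD.
suff main q : (forall m, S (f (mcoeff m q))) ->
    (S (mmap f a q) /\ S (mmap f b q)) /\ (forall i, S (mmap f a (mderiv i q))) /\
    exists s : 'I_n -> 'I_n -> B, (forall i j, S (s i j)) /\
    mmap f b q = mmap f a q + \sum_i h i * mmap f a (mderiv i q)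
               + \sum_i \sum_j h i * h j * s i j.
  by move=> /main[_ [_]].
move: q; apply: (@mpoly_ring_ind A n _ (fun q =>
    (S (mmap f a q) /\ S (mmap f b q)) /\ (forall i, S (mmap f a (mderiv i q))) /\
    exists s : 'I_n -> 'I_n -> B, (forall i j, S (s i j)) /\
    mmap f b q = mmap f a q + \sum_i h i * mmap f a (mderiv i q)
               + \sum_i \sum_j h i * h j * s i j) sf) => {p} [c Sc|i|p q|p q].
- split; first by rewrite !mmap_const.
  split=> [i|]; first by rewrite mderivC mmap0; apply: subring0.
  exists (fun _ _ => 0); split=> [*|]; first exact: subring0.
  rewrite !mmap_const !big1 ?addr0 // => i _; last by rewrite mderivC mmap0 mulr0.
  by rewrite big1 // => j _; rewrite mulr0.
- split; first by rewrite !mmap_var.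
  split=> [j|].
    rewrite mderiv_var mmap_const rmorph_nat; case: (_ == _).
      exact: (subring1 sS).
    exact: (subring0 sS).
  exists (fun _ _ => 0); split=> [*|]; first exact: subring0.
  rewrite !mmap_var (bigD1 i) //= mderiv_var eqxx mmap_const rmorph1 mulr1.
  rewrite big1 ?addr0 => [|j /negPf neq_ji].
    by rewrite big1 ?addr0 // => j _; rewrite big1 // => l _; rewrite mulr0.
  by rewrite mderiv_var eq_sym neq_ji mmap_const rmorph0 mulr0.
- move=> [[Sp0 Spb] [Sp1 [s [Ss pE]]]] [[Sq0 Sqb] [Sq1 [t [St qE]]]].
  split; first by rewrite !mmapD; split; apply: subringD.
  split=> [i|]; first by rewrite mderivD mmapD; apply: subringD.
  exists (fun i j => s i j + t i j); split=> [i j|]; first exact: subringD.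
  rewrite !mmapD pE qE.
  have -> : \sum_i h i * mmap f a (mderiv i (p + q)) =
    \sum_i h i * mmap f a (mderiv i p) + \sum_i h i * mmap f a (mderiv i q).
    by rewrite -big_split; apply: eq_bigr => i _; rewrite mderivD mmapD mulrDr.
  have -> : \sum_i \sum_j h i * h j * (s i j + t i j) =
    \sum_i \sum_j h i * h j * s i j + \sum_i \sum_j h i * h j * t i j.
    rewrite -big_split; apply: eq_bigr => i _; rewrite -big_split.
    by apply: eq_bigr => j _; rewrite mulrDr.
  ring.
move=> [[Sp0 Spb] [Sp1 [s [Ss pE]]]] [[Sq0 Sqb] [Sq1 [t [St qE]]]].
split; first by rewrite !mmapM; split; apply: (subringM sS).
split=> [i|].
  by rewrite mderivM mmapD !mmapM; apply: subringD => //; apply: (subringM sS).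
pose p0 := mmap f a p; pose q0 := mmap f a q.
pose p1 := \sum_i h i * mmap f a (mderiv i p).
pose q1 := \sum_i h i * mmap f a (mderiv i q).
have Sp01 : S (p0 + p1).
  apply: subringD => //; apply: subring_sum => // i _; exact: (subringM sS).
exists (fun i j => mmap f a (mderiv i p) * mmap f a (mderiv j q)
  + s i j * mmap f b q + (p0 + p1) * t i j).
split=> [i j|].
  by apply: subringD => //; [apply: subringD => //|]; apply: (subringM sS).
have -> : \sum_i h i * mmap f a (mderiv i (p * q)) = p1 * q0 + p0 * q1.
  rewrite mulr_suml mulr_sumr -big_split; apply: eq_bigr => i _ /=.
  by rewrite mderivM mmapD !mmapM /= -/p0 -/q0; ring.
have -> : \sum_i \sum_j h i * h j * (mmap f a (mderiv i p) * mmap f a (mderiv j q)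
  + s i j * mmap f b q + (p0 + p1) * t i j) =
  p1 * q1 + (\sum_i \sum_j h i * h j * s i j) * mmap f b q
   + (p0 + p1) * \sum_i \sum_j h i * h j * t i j.
  rewrite mulr_suml [X in _ + X + _]mulr_suml [X in _ + _ + X]mulr_sumr -!big_split.
  apply: eq_bigr => i _ /=; rewrite mulr_sumr [X in _ + X + _]mulr_suml.
  rewrite [X in _ + _ + X]mulr_sumr -!big_split.
  by apply: eq_bigr => j _ /=; ring.
have -> : mmap f b (p * q) = mmap f b p * mmap f b q by rewrite mmapM.
have -> : mmap f a (p * q) = p0 * q0 by rewrite mmapM.
by rewrite qE pE -/p0 -/q0 -/p1 -/q1; ring.
Qed.

(** * Newton iteration along a filtration *)

(** Powers of an ideal of a subring.  Both the Rees filtration of a finitely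
    generated subring and the t-adic filtration of a polynomial ring are of
    this kind. *)
Record is_filtration (A : comNzRingType) (F : nat -> A -> Prop) : Prop :=
  IsFiltration {
  filtration_subring : is_subring (F 0%N);
  filtrationD : forall j x y, F j x -> F j y -> F j (x + y);
  filtrationM : forall i j x y, F i x -> F j y -> F (i + j)%N (x * y);
  filtrationS : forall j x, F j.+1 x -> F j x;
  filtration0 : forall j, F j 0 }.

Section filtration.
Variables (A : comNzRingType) (F : nat -> A -> Prop).
Hypothesis filF : is_filtration F.

Lemma filtrationN j x : F j x -> F j (- x).
Proof.
have sF := filtration_subring filF.
rewrite -mulN1r -[X in F X (_ * _)]add0n => Fx; apply: (filtrationM filF) => //.
by apply: subringN => //; apply: (subring1 sF).
Qed.

Lemma filtrationB j x y : F j x -> F j y -> F j (x - y).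
Proof. by move=> Fx Fy; apply: (filtrationD filF) => //; apply: filtrationN. Qed.

Lemma filtration_le i j x : (i <= j)%N -> F j x -> F i x.
Proof. by elim: j => [|j IHj]; rewrite leq_eqVlt => /predU1P[->|] // + /(filtrationS filF). Qed.

Lemma filtration_sum j (J : Type) (r : seq J) (P : pred J) (f : J -> A) :
  (forall l, P l -> F j (f l)) -> F j (\sum_(l <- r | P l) f l).
Proof. by move=> Ff; apply: big_ind => //; [apply: (filtration0 filF)|apply: (filtrationD filF)]. Qed.

Lemma filtration_meval n (p : mpoly n A) (x : 'I_n -> A) :
  (forall m, F 0%N (mcoeff m p)) -> (forall i, F 1%N (x i)) ->
  F 1%N (meval x p - meval (fun=> 0) p).
Proof.
move=> pF xF; have sF := filtration_subring filF.
have [] : F 0%N (meval (fun=> 0) p) /\ F 1%N (meval x p - meval (fun=> 0) p); last by [].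
move: p pF; apply: (@mpoly_ring_ind A n _ (fun p => F 0%N (meval (fun=> 0) p) /\
  F 1%N (meval x p - meval (fun=> 0) p)) sF) => [c Sc|i|p q [p0 p1] [q0 q1]|p q [p0 p1] [q0 q1]].
- by rewrite !mevalC subrr; split=> //; apply: (filtration0 filF).
- by rewrite !mevalXU subr0; split=> //; apply: subring0.
- by rewrite !mevalD opprD addrACA; split; [apply: subringD|apply: (filtrationD filF)].
rewrite !mevalM; split; first exact: (subringM sF).
have -> : meval x p * meval x q - meval (fun=> 0) p * meval (fun=> 0) q =
  (meval x p - meval (fun=> 0) p) * meval x q
  + meval (fun=> 0) p * (meval x q - meval (fun=> 0) q) by ring.
apply: (filtrationD filF); last by rewrite -[1%N]add0n; apply: (filtrationM filF).
rewrite -[1%N]addn0; apply: (filtrationM filF) => //.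
rewrite -[meval x q](subrK (meval (fun=> 0) q)); apply: subringD => //.
exact: (filtrationS filF).
Qed.

Lemma filtration_contraction n (p : mpoly n A) (x y : 'I_n -> A) j :
  (forall m, F 0%N (mcoeff m p)) ->
  (forall l, F 1%N (meval (fun=> 0) (mderiv l p))) ->
  (forall i, F 1%N (x i)) -> (forall i, F 1%N (y i)) ->
  (forall i, F j.+1 (x i - y i)) -> F j.+2 (meval x p - meval y p).
Proof.
move=> pF dF xF yF xyF; have sF := filtration_subring filF.
have [||m|s [sFs]] := @taylor A A idfun n _ y (fun i => x i - y i) p sF.
- by move=> i; apply: (filtrationS filF).
- by move=> i; apply: (filtration_le (j := j.+1)).
- exact: pF.
rewrite (@eq_mmap _ _ _ idfun _ x) => [|i]; last by rewrite addrC subrK.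
rewrite -/(meval x p) -/(meval y p) => ->.
rewrite -[X in X - _]addrA [X in X - _]addrC addrK; apply: (filtrationD filF).
  apply: filtration_sum => i _; rewrite -[j.+2]addn1; apply: (filtrationM filF) => //.
  rewrite -[mmap _ _ _](subrK (meval (fun=> 0) (mderiv i p))).
  apply: (filtrationD filF) => //; apply: filtration_meval => //.
  exact: coef_mderiv.
apply: filtration_sum => i _; apply: filtration_sum => l _.
rewrite -[j.+2]addn0; apply: (filtrationM filF) => //.
rewrite -[j.+2]addn1; apply: (filtrationM filF) => //.
by apply: filtration_le (xyF l).
Qed.

(** By filtration_contraction each application of G gains one step of the
    filtration. *)
Lemma approximate_fixpoint n (G : 'I_n -> mpoly n A) :
  (forall i m, F 0%N (mcoeff m (G i))) ->
  (forall i, F 1%N (meval (fun=> 0) (G i))) ->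
  (forall i l, F 1%N (meval (fun=> 0) (mderiv l (G i)))) ->
  forall j, exists z : 'I_n -> A,
    (forall i, F 1%N (z i)) /\ forall i, F j.+1 (z i - meval z (G i)).
Proof.
move=> GF G0 dG; elim=> [|j [z [zF zG]]].
  exists (fun=> 0); split=> i; first exact: (filtration0 filF).
  by rewrite sub0r; apply: filtrationN.
have GzF i : F 1%N (meval z (G i)).
  rewrite -[meval _ _](subKr (z i)); apply: filtrationB => //.
  by apply: filtration_le (zG i).
exists (fun i => meval z (G i)); split=> // i.
by apply: filtration_contraction.
Qed.
End filtration.

(** * Rescaling by the Jacobian *)

(** In the direction e C, where D f(a) C = e I, the linear part of f is e^2
    times the identity and all further terms are divisible by e^2; dividing by
    e^2 leaves an equation w = G(w) whose right-hand side is contracting. *)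
Lemma jacobian_rescaling (A : comNzRingType) (I : A -> Prop) n k
    (f : 'I_k -> mpoly n A) (a u : 'I_n -> A) (c : 'I_k -> A) (e : A)
    (C : 'I_n -> 'I_k -> A) :
  is_ideal I -> (forall i, meval a (f i) = e ^+ 2 * c i) ->
  (forall i, I (c i)) -> (forall l, I (u l)) ->
  (forall i j, \sum_l meval a (mderiv l (f i)) * C l j = e * (i == j)%:R) ->
  exists G : 'I_k -> mpoly k A,
    [/\ forall i, I (meval (fun=> 0) (G i)),
        forall i l, I (meval (fun=> 0) (mderiv l (G i))) &
        forall (w : 'I_k -> A) i,
          meval (fun l => a l + (e ^+ 2 * u l + e * \sum_j C l j * w j)) (f i) =
          e ^+ 2 * (w i - meval w (G i))].
Proof.
move=> idI fa Ic Iu DC.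
pose B : comNzRingType := mpoly k A.
pose cst : {rmorphism A -> B} := @mpolyC k A.
(* The increment is e q with q(0) in I, so its quadratic terms carry e^2. *)
pose q l : B := cst (e * u l) + \sum_j cst (C l j) * mvar j.
pose a' l := cst (a l); pose h l := cst e * q l.
have q0 l : I (meval (fun=> 0) (q l)).
  rewrite mevalD mevalC raddf_sum big1 /= ?addr0 => [|j _].
    by apply: (idealM idI).
  by rewrite mevalM mevalXU mulr0.
have /choice[s sE] : forall i, exists s : 'I_n -> 'I_n -> B,
    mmap cst (fun l => a' l + h l) (f i) =
    mmap cst a' (f i) + \sum_l h l * mmap cst a' (mderiv l (f i))
               + \sum_l \sum_l' h l * h l' * s l l'.
  move=> i; have [//|//|//|s [_ sE]] := @taylor _ _ cst n _ a' h (f i) (subringT B).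
  by exists s.
pose G i : B := - (cst (c i) + \sum_l cst (meval a (mderiv l (f i)) * u l)
   + \sum_l \sum_l' q l * q l' * s i l l').
exists G.
have csta p : mmap cst a' p = cst (meval a p).
  by rewrite /meval (rmorph_mmap (g := cst) (b := a')).
split=> [i|i j|w i].
- rewrite mevalN !mevalD mevalC; apply: idealN => //.
  apply: (idealD idI); first apply: (idealD idI) => //.
    rewrite raddf_sum; apply: ideal_sum => // l _ /=; rewrite mevalC.
    exact: (idealM idI).
  rewrite raddf_sum; apply: ideal_sum => // l _ /=; rewrite raddf_sum.
  apply: ideal_sum => // l' _ /=; rewrite !mevalM; apply: idealMr => //.
  exact: idealMr.
- rewrite mderivN mevalN !mderivD !mevalD mderivC meval0 add0r; apply: idealN => //.
  apply: (idealD idI).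
    rewrite [mderiv _ _]raddf_sum raddf_sum; apply: ideal_sum => // l _ /=.
    by rewrite mderivC meval0; apply: (ideal0 idI).
  rewrite [mderiv _ _]raddf_sum raddf_sum; apply: ideal_sum => // l _ /=.
  rewrite [mderiv _ _]raddf_sum raddf_sum; apply: ideal_sum => // l' _ /=.
  rewrite !mderivM mevalD !mevalM mevalD !mevalM; apply: (idealD idI); last first.
    by apply: idealMr => //; apply: idealMr.
  apply: idealMr => //; apply: (idealD idI); first exact: (idealM idI).
  exact: idealMr.
have fE : mmap cst (fun l => a' l + h l) (f i) = cst (e ^+ 2) * (mvar i - G i).
  rewrite sE csta fa rmorphM -addrA -[X in _ + X]addrC.
  have -> : \sum_l \sum_l' h l * h l' * s i l l' =
      cst (e ^+ 2) * \sum_l \sum_l' q l * q l' * s i l l'.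
    rewrite mulr_sumr; apply: eq_bigr => l _; rewrite mulr_sumr.
    by apply: eq_bigr => l' _; rewrite /h rmorphXn; ring.
  have -> : \sum_l h l * mmap cst a' (mderiv l (f i)) =
      cst (e ^+ 2) * (\sum_l cst (meval a (mderiv l (f i)) * u l) + mvar i).
    transitivity (\sum_l cst (e ^+ 2) * cst (meval a (mderiv l (f i)) * u l)
      + \sum_l cst e * \sum_j cst (meval a (mderiv l (f i)) * C l j) * mvar j).
      rewrite -big_split; apply: eq_bigr => l _ /=.
      rewrite csta /h /q mulrDr mulrDl !rmorphM /=; congr (_ + _).
        by ring.
      rewrite -mulrA mulr_suml; congr (_ * _); apply: eq_bigr => j _.
      by rewrite !rmorphM; ring.
    rewrite -!mulr_sumr mulrDr; congr (_ + _).
    rewrite exchange_big /= (bigD1 i) //= -mulr_suml -rmorph_sum DC eqxx mulr1.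
    rewrite big1 ?addr0 => [|j /negPf neq_ji].
      by rewrite mulrA -rmorphM.
    by rewrite -mulr_suml -rmorph_sum DC eq_sym neq_ji mulr0 rmorph0 mul0r.
  by rewrite /G; ring.
have := congr1 (meval w) fE; rewrite mevalM mevalC mevalB mevalXU => <-.
rewrite /meval; apply/esym/rmorph_mmap => [x|l]; first exact: mevalC.
rewrite -[LHS]/(meval w (cst (a l) + cst e * (cst (e * u l) + _))).
rewrite mevalD mevalC mevalM mevalC mevalD mevalC raddf_sum /=.
rewrite mulrDr mulrA -expr2; congr (_ + (_ + e * _)).
by apply: eq_bigr => j _; rewrite mevalM mevalC mevalXU.
Qed.

(** * Scalars embed in the germs of solutions *)

Section rees.
Variables (R : idomainType) (I : R -> Prop) (s t : seq R).
Hypotheses (idI : is_ideal I) (I1 : ~ I 1) (tI : forall a, a \in t -> I a).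
Hypothesis ts : {subset t <= s}.

Let gens : seq {poly R} := [seq a%:P | a <- s] ++ [seq a *: 'X | a <- t].

(** The Rees algebra of the ideal generated by t in the subring generated by
    s: membership of x *: 'X^j says that x lies in the j-th power. *)
Definition rees_power (j : nat) (x : R) : Prop := generated gens (x *: 'X^j).

Let sg := generated_subring gens.

(* The degree of a term may be lowered since every element of t is also in s. *)
Let rees_lower (f : {poly R}) : generated gens f ->
  forall a i, (i <= a)%N -> rees_power i f`_a.
Proof.
rewrite /rees_power => /(_ (fun f => forall a i, (i <= a)%N -> generated gens (f`_a *: 'X^i))).
apply=> [|g]; last first.
  rewrite mem_cat => /orP[] /mapP[x xs ->] a i le_ia.
    rewrite coefC; case: eqP => [a0|_]; last by rewrite scale0r; apply: (subring0 sg).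
    have -> : i = 0%N by move: le_ia; rewrite a0 leqn0 => /eqP.
    rewrite expr0 alg_polyC; apply: generated_mem; rewrite mem_cat.
    by apply/orP; left; apply: map_f.
  rewrite coefZ coefX; case: eqP => [a1|_]; last first.
    by rewrite mulr0 scale0r; apply: (subring0 sg).
  rewrite mulr1; move: le_ia; rewrite a1; case: i => [_|[|//] _].
    rewrite expr0 alg_polyC; apply: generated_mem; rewrite mem_cat.
    by apply/orP; left; apply/map_f/ts.
  by rewrite expr1; apply: generated_mem; rewrite mem_cat; apply/orP; right; apply: map_f.
split=> [a i|x y xL yL a i le_ia|x y xL yL a i le_ia].
- rewrite coef1; case: eqP => [->|_ _]; last by rewrite scale0r; apply: (subring0 sg).
  by rewrite leqn0 => /eqP ->; rewrite expr0 scale1r; apply: (subring1 sg).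
- by rewrite coefB scalerBl; apply: (subringB sg); [apply: xL|apply: yL].
- rewrite coefM scaler_suml; apply: subring_sum => // b _.
  have -> : (x`_b * y`_(a - b)) *: 'X^i =
      (x`_b *: 'X^(minn i b)) * (y`_(a - b) *: 'X^(i - minn i b)).
    by rewrite -scalerAl -scalerAr scalerA -exprD subnKC ?geq_minl.
  apply: (subringM sg); first by apply: xL; exact: geq_minr.
  apply: yL; rewrite leq_subLR; case: (leqP i b) => [le_ib|lt_bi].
    by rewrite leq_addr.
  by rewrite subnKC // -ltnS.
Qed.

Lemma rees_filtration : is_filtration rees_power.
Proof.
split=> [|j x y|i j x y|j x|j]; rewrite /rees_power.
- split=> [|x y|x y]; rewrite ?expr0 ?scale1r.
  + exact: (subring1 sg).
  + by rewrite scalerBl; apply: (subringB sg).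
  + move=> xg yg; rewrite -scalerA -[1]mulr1 scalerAr scalerAl.
    exact: (subringM sg).
- by rewrite scalerDl; apply: subringD.
- move=> xg yg; rewrite -scalerA exprD scalerAr scalerAl; exact: (subringM sg).
- by move/rees_lower/(_ j.+1 j (leqnSn j)); rewrite /rees_power coefZ coefXn eqxx mulr1.
- by rewrite scale0r; apply: (subring0 sg).
Qed.

Lemma rees_power0 x : x \in s -> rees_power 0 x.
Proof.
move=> xs; rewrite /rees_power expr0 alg_polyC; apply: generated_mem.
by rewrite mem_cat; apply/orP; left; apply: map_f.
Qed.

Lemma rees_power1 x : x \in t -> rees_power 1 x.
Proof.
move=> xs; rewrite /rees_power expr1; apply: generated_mem.
rewrite mem_cat; apply/orP; right.
exact: (map_f (fun a => a *: 'X)).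
Qed.

(** Krull's intersection theorem.  The Rees algebra is noetherian, so some
    c X^n is a combination of the c X^j with j < n; in degree n this says
    c = c d with d in the ideal I. *)
Lemma krull_intersection (c : R) : (forall j, rees_power j c) -> c = 0.
Proof.
move=> cP; have [n [r [rg]]] := generated_noetherian cP.
move=> /(congr1 (fun p : {poly R} => p`_n)).
rewrite coefZ coefXn eqxx mulr1 coef_sum.
have rI (f : {poly R}) : generated gens f -> forall a, (0 < a)%N -> I f`_a.
  move=> /(_ (fun f => forall a, (0 < a)%N -> I f`_a)); apply=> [|g]; last first.
    rewrite mem_cat => /orP[] /mapP[x xs ->] a a_gt0.
      by rewrite coefC eqn0Ngt a_gt0; apply: (ideal0 idI).
    by rewrite coefZ; apply: idealMr => //; apply: tI.
  split=> [a|x y xL yL a a_gt0|x y xL yL a a_gt0].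
  - by rewrite lt0n coef1 => /negPf ->; apply: (ideal0 idI).
  - by rewrite coefB; apply: idealB => //; [apply: xL|apply: yL].
  - rewrite coefM; apply: ideal_sum => // b _.
    have [b0|b_gt0] := posnP b; last by apply: idealMr => //; apply: xL.
    by apply: (idealM idI); apply: yL; rewrite b0 subn0.
under eq_bigr => i _ do
  rewrite -scalerAr coefZ coefMXn ltnNge ltnW ?ltn_ord //=.
rewrite -mulr_sumr => cE; apply/eqP; apply: contrapT => /negP c0; apply: I1.
have -> : 1 = \sum_(i < n) (r i)`_(n - i).
  by apply: (mulfI c0); rewrite mulr1.
by apply: ideal_sum => // i _; apply: rI; rewrite ?subn_gt0.
Qed.
End rees.

Lemma coef_generated (A : comNzRingType) n (S : A -> Prop) (p : mpoly n A) :
  is_subring S -> (forall a, a \in [seq mcoeff m p | m <- msupp p] -> S a) ->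
  forall m, S (mcoeff m p).
Proof.
move=> sS pS m; have [mp|/memN_msupp_eq0 ->] := boolP (m \in msupp p).
  exact/pS/map_f.
exact: subring0.
Qed.

(** Evaluating the relation at better and better approximate solutions puts c
    into all powers of the ideal generated by the G_i(0) and the first
    derivatives of the G_i at 0. *)
Lemma fixpoint_torsion_free (R : idomainType) (I : R -> Prop) k
    (G h : 'I_k -> mpoly k R) (g : mpoly k R) (c : R) :
  is_ideal I -> ~ I 1 ->
  (forall i, I (meval (fun=> 0) (G i))) ->
  (forall i l, I (meval (fun=> 0) (mderiv l (G i)))) ->
  meval (fun=> 0) g = 1 ->
  mpolyC k c * g = \sum_i h i * (mpolyX R (mnm1 i) - G i) -> c = 0.
Proof.
move=> idI I1 G0 dG g0 gE.
pose t := [seq meval (fun=> 0) (G i) | i : 'I_k]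
  ++ [seq meval (fun=> 0) (mderiv il.2 (G il.1)) | il : 'I_k * 'I_k].
pose co (p : mpoly k R) := [seq mcoeff m p | m <- msupp p].
pose s := c :: t ++ co g ++ flatten [seq co (G i) | i : 'I_k]
  ++ flatten [seq co (h i) | i : 'I_k].
have tI a : a \in t -> I a.
  by rewrite mem_cat => /orP[/fintype.imageP[i _ ->]|/fintype.imageP[il _ ->]].
have ts : {subset t <= s} by move=> a at_; rewrite inE mem_cat at_ orbT.
have filF := rees_filtration ts; have sF := filtration_subring filF.
have s0 := @rees_power0 R s t; have t1 := @rees_power1 R s t.
set F := rees_power s t in filF sF s0 t1.
have gF m : F 0%N (mcoeff m g).
  by apply: coef_generated => // a ag; apply: s0; rewrite inE !mem_cat ag !orbT.
have GF i m : F 0%N (mcoeff m (G i)).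
  apply: coef_generated => // a aG; apply: s0; rewrite inE !mem_cat; do 3 (apply/orP; right).
  by apply/orP; left; apply/flattenP; exists (co (G i)) => //; apply/fintype.imageP; exists i.
have hF i m : F 0%N (mcoeff m (h i)).
  apply: coef_generated => // a aG; apply: s0; rewrite inE !mem_cat; do 4 (apply/orP; right).
  by apply/flattenP; exists (co (h i)) => //; apply/fintype.imageP; exists i.
have GF0 i : F 1%N (meval (fun=> 0) (G i)).
  by apply: t1; rewrite mem_cat; apply/orP; left; apply/fintype.imageP; exists i.
have GF1 i l : F 1%N (meval (fun=> 0) (mderiv l (G i))).
  by apply: t1; rewrite mem_cat; apply/orP; right; apply/fintype.imageP; exists (i, l).
apply: (krull_intersection idI I1 tI) => j; rewrite -/(rees_power s t j c) -/F.
elim: j => [|j IHj]; first by apply: s0; rewrite inE eqxx.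
have [z [zF zG]] := approximate_fixpoint filF GF GF0 GF1 j.
(* If c lies in the j-th power, so that c (g(z) - 1) lies in the next one, and
   c g(z) does by the approximate vanishing, then so does c. *)
have -> : c = c * meval z g - c * (meval z g - meval (fun=> 0) g).
  by rewrite g0; ring.
apply: (filtrationB filF); last first.
  by rewrite -addn1; apply: (filtrationM filF) => //; apply: filtration_meval.
have -> : c * meval z g = \sum_i meval z (h i) * (z i - meval z (G i)).
  rewrite -[X in X * _](mevalC z) -mevalM gE raddf_sum; apply: eq_bigr => i _ /=.
  by rewrite mevalM mevalB mevalXU.
apply: (filtration_sum filF) => i _; rewrite -[j.+1]add0n; apply: (filtrationM filF) => //.
apply: (@mmap_closed _ _ idfun k (F 0%N) z sF) => [l|m]; last exact: hF.
by apply: (filtrationS filF).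
Qed.

(** * Algebraic dependence by counting monomials *)

(** Gaussian elimination without division. *)
Lemma linear_dependence (R : idomainType) n m (A : 'I_m -> 'I_n -> R) :
  (n < m)%N ->
  exists v : 'I_m -> R, (exists i, v i != 0) /\ forall j, \sum_i v i * A i j = 0.
Proof.
elim: n m A => [|n IHn] [//|m] A lt_nm.
  by exists (fun=> 1); split=> [|[]//]; exists ord0; exact: oner_neq0.
have [[i0 p0]|nopiv] := pselect (exists i, A i ord_max != 0); last first.
  have [v [v0 vA]] := IHn m.+1 (fun i j => A i (widen_ord (leqnSn n) j)) (ltnW lt_nm).
  exists v; split=> // j; have [lt_jn|ge_jn] := ltnP j n.
    rewrite -[RHS](vA (Ordinal lt_jn)); apply: eq_bigr => i _.
    by congr (_ * A _ _); apply: val_inj.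
  have -> : j = ord_max by apply/val_inj/anti_leq; rewrite ge_jn -ltnS ltn_ord.
  rewrite big1 // => i _; apply/eqP; rewrite mulf_eq0; apply/orP; right.
  by apply/negPn/negP => Ai; apply: nopiv; exists i.
pose B (i : 'I_m) (j : 'I_n) := A i0 ord_max * A (lift i0 i) (widen_ord (leqnSn n) j)
  - A (lift i0 i) ord_max * A i0 (widen_ord (leqnSn n) j).
have [v [[i vi] vB]] := IHn m B lt_nm.
pose w i := if unlift i0 i is Some i' then A i0 ord_max * v i'
  else - \sum_i' v i' * A (lift i0 i') ord_max.
exists w; split; first by exists (lift i0 i); rewrite /w liftK mulf_neq0.
move=> j; rewrite (bigD1_ord i0) //= {1}/w unlift_none.
under eq_bigr do rewrite /w liftK.
have [lt_jn|ge_jn] := ltnP j n.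
  rewrite -[RHS](vB (Ordinal lt_jn)) mulNr mulr_suml -sumrN -big_split /=.
  apply: eq_bigr => i' _; rewrite /B.
  have -> : widen_ord (leqnSn n) (Ordinal lt_jn) = j by apply: val_inj.
  ring.
have -> : j = ord_max by apply/val_inj/anti_leq; rewrite ge_jn -ltnS ltn_ord.
rewrite mulNr mulr_suml -sumrN -big_split big1 // => i' _ /=; ring.
Qed.

Lemma card_bmultinom k d : (#|{: bmultinom k d}| <= d ^ k)%N.
Proof.
have lt_md (m : bmultinom k d) i : (bmnm m i < d)%N.
  apply: leq_ltn_trans (bmdeg m); rewrite mdegE (bigD1 i) //=; exact: leq_addr.
pose g (m : bmultinom k d) : {ffun 'I_k -> 'I_d} := [ffun i => Ordinal (lt_md m i)].
have g_inj : injective g.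
  move=> m1 m2 /ffunP g12; apply/eqP; rewrite bmeqP; apply/eqP/mnmP => i.
  by have := congr1 val (g12 i); rewrite !ffunE.
by rewrite (leq_trans (leq_card _ g_inj)) // card_ffun !card_ord.
Qed.

Lemma mpoly_dependence (R : idomainType) k d (T : finType) (f : T -> mpoly k R) :
  (forall t, (mmeasure mdeg (f t) <= d)%N) -> (d ^ k < #|T|)%N ->
  exists c : T -> R, (exists t, c t != 0) /\ \sum_t mpolyC k (c t) * f t = 0.
Proof.
move=> fd ltT.
have ltm : (#|{: bmultinom k d}| < #|T|)%N by apply: leq_ltn_trans ltT; exact: card_bmultinom.
have [v [[i vi] vA]] := linear_dependence
  (fun i j => mcoeff (bmnm (enum_val j)) (f (enum_val i))) ltm.
exists (v \o enum_rank); split; first by exists (enum_val i); rewrite /= enum_valK.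
apply/mpolyP => m; rewrite mcoeff0 raddf_sum /=.
have [lt_md|ge_md] := ltnP (mdeg m) d; last first.
  rewrite big1 // => t _; rewrite mcoeffCM memN_msupp_eq0 ?mulr0 //.
  by apply: msize_mdeg_ge; apply: leq_trans ge_md.
rewrite -[RHS](vA (enum_rank (BMultinom lt_md))) (reindex (@enum_val T T)) /=; last first.
  exact: (onW_bij _ (enum_val_bij _)).
by apply: eq_bigr => j _; rewrite mcoeffCM enum_valK enum_rankK.
Qed.

Lemma msize_mulS (R : idomainType) k (p q : mpoly k R) a b :
  (mmeasure mdeg p <= a.+1)%N -> (mmeasure mdeg q <= b.+1)%N ->
  (mmeasure mdeg (p * q) <= (a + b).+1)%N.
Proof.
move=> pa qb; have [->|p0] := eqVneq p 0; first by rewrite mul0r msize0.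
have [->|q0] := eqVneq q 0; first by rewrite mulr0 msize0.
rewrite msizeM //; move: pa qb.
rewrite -(leq_add2r (b.+1)) => le_pa le_qb.
rewrite -ltnS prednK; last by rewrite addn_gt0 lt0n msize_poly_eq0 p0.
by rewrite -addSn -addnS (leq_trans _ le_pa) // leq_add2l.
Qed.

Lemma msize_expS (R : idomainType) k (p : mpoly k R) a n :
  (mmeasure mdeg p <= a.+1)%N -> (mmeasure mdeg (p ^+ n) <= (n * a).+1)%N.
Proof.
move=> pa; elim: n => [|n IHn]; first by rewrite expr0 msize1.
by rewrite exprS mulSn; apply: msize_mulS.
Qed.

(** There are M^(k+1) products of powers of the k + 1 polynomials with
    exponents below M, and these lie in a space of dimension O(M^k). *)
Lemma algebraic_dependence (R : idomainType) k (F : 'I_k -> mpoly k R) (y : mpoly k R) :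
  exists M (c : {ffun 'I_k -> 'I_M} -> 'I_M -> R), (exists a b, c a b != 0) /\
    \sum_(a : {ffun 'I_k -> 'I_M}) \sum_(b < M)
      mpolyC k (c a b) * ((\prod_i F i ^+ a i) * y ^+ b) = 0.
Proof.
pose d := maxn (mmeasure mdeg y) (\max_i mmeasure mdeg (F i)).
have yd : (mmeasure mdeg y <= d.+1)%N by rewrite ltnW // ltnS leq_maxl.
have Fd i : (mmeasure mdeg (F i) <= d.+1)%N.
  by rewrite ltnW // ltnS leq_max; apply/orP; right; apply: leq_bigmax.
(* The products have degree at most (k + 1) d M, and M is chosen so that
   ((k + 1) d + 1)^k M^k < M^(k+1). *)
pose M := ((k.+1 * d).+1 ^ k).+1.
pose T := ({ffun 'I_k -> 'I_M} * 'I_M)%type.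
pose f (ab : T) := (\prod_i F i ^+ ab.1 i) * y ^+ ab.2.
have [||c [[[a b] cab] cE]] := @mpoly_dependence R k ((k.+1 * d).+1 * M)%N T f.
- move=> [a b]; rewrite /f /=.
  have lt_M (i : 'I_M) : (i * d <= M.-1 * d)%N by rewrite leq_mul2r -ltnS ltn_ord orbT.
  have prodF (r : seq 'I_k) : (mmeasure mdeg (\prod_(i <- r) F i ^+ a i) <=
      (size r * (M.-1 * d)).+1)%N.
    elim: r => [|i r IHr]; first by rewrite big_nil msize1.
    rewrite big_cons mulSn; apply: msize_mulS => //.
    by apply: leq_trans (msize_expS _ (Fd i)) _; rewrite ltnS.
  have le_b : (mmeasure mdeg (y ^+ b) <= (M.-1 * d).+1)%N.
    by apply: leq_trans (msize_expS _ yd) _; rewrite ltnS.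
  have := msize_mulS (prodF (index_enum _)) le_b.
  have -> : size (index_enum 'I_k) = k by rewrite -[RHS]card_ord cardT enumT.
  move/leq_trans; apply; rewrite -mulSnr [X in (_ <= X)%N]mulSn addnC -[X in (X <= _)%N]addn1.
  rewrite leq_add // -mulnA leq_mul2l [(d * _)%N]mulnC leq_mul2r.
  by rewrite leq_pred !orbT.
- by rewrite card_prod card_ffun !card_ord expnMn [X in (X < _)%N]mulnC ltn_pmul2l ?expn_gt0.
exists M, (fun a b => c (a, b)); split; first by exists a, b.
by rewrite pair_big /= -[RHS]cE; apply: eq_bigr => -[a' b'] _.
Qed.

(** Uniqueness of base M expansions. *)
Lemma digits_inj k M (a b : {ffun 'I_k -> 'I_M}) :
  (\sum_(i < k) a i * M ^ i = \sum_(i < k) b i * M ^ i)%N -> a = b.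
Proof.
elim: k a b => [|k IHk] a b; first by move=> _; apply/ffunP => -[].
rewrite !big_ord_recl /= !expn0 !muln1.
have shift (c : {ffun 'I_k.+1 -> 'I_M}) :
    (\sum_(i < k) c (lift ord0 i) * M ^ (bump 0 i) =
     (\sum_(i < k) [ffun i => c (lift ord0 i)] i * M ^ i) * M)%N.
  by rewrite big_distrl /=; apply: eq_bigr => i _; rewrite ffunE -mulnA -expnSr.
rewrite !shift => eq_ab.
have M_gt0 : (0 < M)%N by apply: leq_ltn_trans (ltn_ord (a ord0)).
have ab0 : a ord0 = b ord0.
  apply: val_inj; have := congr1 (modn^~ M) eq_ab.
  by rewrite ![(_ + _ * M)%N]addnC !modnMDl !modn_small.
move: eq_ab; rewrite ab0 => /addnI/eqP; rewrite eqn_pmul2r // => /eqP/IHk eq_ab.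
apply/ffunP => i; case: (unliftP ord0 i) => [j|] ->; last by rewrite ab0.
by have := congr1 (fun f : {ffun _} => f j) eq_ab; rewrite !ffunE.
Qed.

(** * Nonsingular zeros are algebraic *)

Section ideal_congruence.
Variables (A : comNzRingType) (I : A -> Prop).
Hypothesis idI : is_ideal I.

Lemma ideal_eq_mul x x' y y' : I (x - x') -> I (y - y') -> I (x * y - x' * y').
Proof.
move=> Ix Iy; have -> : x * y - x' * y' = (x - x') * y + x' * (y - y') by ring.
by apply: (idealD idI); [apply: idealMr|apply: (idealM idI)].
Qed.

Lemma ideal_eq_exp x x' n : I (x - x') -> I (x ^+ n - x' ^+ n).
Proof.
move=> Ix; elim: n => [|n IHn]; first by rewrite !expr0 subrr; apply: (ideal0 idI).
by rewrite !exprS; apply: ideal_eq_mul.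
Qed.

Lemma ideal_eq_prod (J : finType) (f g : J -> A) :
  (forall j, I (f j - g j)) -> I (\prod_j f j - \prod_j g j).
Proof.
move=> fg; elim/big_ind2: _ => // [|x x' y y']; first by rewrite subrr; apply: (ideal0 idI).
exact: ideal_eq_mul.
Qed.
End ideal_congruence.

Definition X_power (A : comNzRingType) (j : nat) (p : {poly A}) : Prop :=
  exists q, p = q * 'X^j.

Lemma X_power_filtration (A : comNzRingType) : is_filtration (@X_power A).
Proof.
split.
- by split=> [|x y|x y] *; [exists 1|exists (x - y)|exists (x * y)]; rewrite expr0 mulr1.
- by move=> j _ _ [x ->] [y ->]; exists (x + y); rewrite mulrDl.
- by move=> i j _ _ [x ->] [y ->]; exists (x * y); rewrite exprD; ring.
- by move=> j _ [x ->]; exists (x * 'X); rewrite exprS mulrA.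
- by move=> j; exists 0; rewrite mul0r.
Qed.

Lemma X_power_ideal (A : comNzRingType) j : is_ideal (@X_power A j).
Proof.
split=> [|_ _ [x ->] [y ->]|a _ [x ->]].
- by exists 0; rewrite mul0r.
- by exists (x + y); rewrite mulrDl.
- by exists (a * x); rewrite mulrA.
Qed.

Lemma meval_map_mpoly (A B : comNzRingType) n (f : {rmorphism A -> B})
    (a : 'I_n -> B) (p : mpoly n A) : meval a (map_mpoly f p) = mmap f a p.
Proof.
rewrite /map_mpoly.
pose g : {rmorphism A -> mpoly n B} := @mpolyC n B \o f.
apply: (rmorph_mmap (f := g) (phi := meval a)) => [c|i] /=.
  exact: mevalC.
exact: mevalXU.
Qed.

Lemma mderiv_map_mpoly (A B : comNzRingType) n (f : {rmorphism A -> B})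
    (p : mpoly n A) l : mderiv l (map_mpoly f p) = map_mpoly f (mderiv l p).
Proof.
apply/mpolyP => m.
by rewrite mcoeff_mderiv !mcoeff_map_mpoly mcoeff_mderiv raddfMn.
Qed.

(** Near the zero z, the system F(x) = Y has a formal solution for every small
    right-hand side Y.  Along the curve Y_i = e^2 t^(M^i) the monomials of an
    algebraic relation between the F_i and x_l have distinct orders in t, so
    its lowest nonzero one yields a relation for z_l alone. *)
Lemma nonsingular_zero_algebraic (R : idomainType) (D : comNzRingType)
    (pi : {rmorphism R -> D}) k (F : 'I_k -> mpoly k R) (z : 'I_k -> D) (l : 'I_k) :
  (forall i, mmap pi z (F i) = 0) ->
  (forall d, \det (\matrix_(i, j) mmap pi z (mderiv j (F i))) * d = 0 -> d = 0) ->
  exists2 P : {poly R}, P != 0 & (map_poly pi P).[z l] = 0.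
Proof.
move=> Fz; set J := \matrix_(i, j) _; set e := \det J => e_reg.
have [M [c [[a0 [b0 c0]] cE]]] := algebraic_dependence F (mpolyX R (mnm1 l)).
pose P (a : {ffun 'I_k -> 'I_M}) : {poly R} := \sum_(b < M) (c a b)%:P * 'X^b.
pose dig (a : {ffun 'I_k -> 'I_M}) := (\sum_(i < k) a i * M ^ i)%N.
have P0 : P a0 != 0.
  apply: contraNneq c0 => /(congr1 (fun p : {poly R} => p`_b0)).
  rewrite coef0 coef_sum (bigD1 b0) //= coefCM coefXn eqxx mulr1 big1 ?addr0.
    by move/eqP.
  by move=> b nb; rewrite coefCM coefXn eq_sym (inj_eq val_inj) (negPf nb) mulr0.
case: (@arg_minnP _ a0 (fun a => P a != 0) dig P0) => a Pa a_min.
exists (P a) => //; pose mu := dig a.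
pose A : comNzRingType := {poly D}; pose t : A := 'X.
pose cD : {rmorphism D -> A} := polyC.
pose rho : {rmorphism R -> A} := cD \o pi.
have filX := X_power_filtration D.
pose Y (i : 'I_k) : A := cD e ^+ 2 * t ^+ (M ^ i).
have M_gt0 : (0 < M)%N by apply: leq_ltn_trans (ltn_ord b0).
pose f i : mpoly k A := map_mpoly rho (F i) - mpolyC k (Y i).
have rhoz p : mmap rho (cD \o z) p = cD (mmap pi z p) by apply/esym/rmorph_mmap.
have [|||||G [G0 dG GE]] := @jacobian_rescaling A (@X_power D 1) k k f (cD \o z)
   (fun=> 0) (fun i => - t ^+ (M ^ i)) (cD e) (fun i j => cD ((\adj J) i j)).
- exact: X_power_ideal.
- by move=> i; rewrite mevalB mevalC meval_map_mpoly rhoz Fz rmorph0 sub0r mulrN.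
- move=> i; apply: filtrationN => //; exists (t ^+ (M ^ i).-1).
  by rewrite -exprD addn1 prednK // expn_gt0 M_gt0.
- by move=> i; exists 0; rewrite mul0r.
- move=> i j; transitivity (cD ((J *m \adj J) i j)).
    rewrite mxE rmorph_sum; apply: eq_bigr => s _.
    rewrite mderivB mderivC subr0 mderiv_map_mpoly meval_map_mpoly rhoz.
    by rewrite [J i s]mxE; exact: (esym (rmorphM cD _ _)).
  by rewrite mul_mx_adj mxE rmorphMn mulr_natr.
have [|//|//|w [wX wG]] := @approximate_fixpoint A (@X_power D) filX k G _ _ _ mu.
  by move=> i m; exists (mcoeff m (G i)); rewrite expr0 mulr1.
pose xi i : A := cD (z i) + (cD e ^+ 2 * 0 + cD e * \sum_j cD ((\adj J) i j) * w j).
have Fxi i : X_power mu.+1 (mmap rho xi (F i) - Y i).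
  have := GE w i; rewrite mevalB mevalC meval_map_mpoly => ->.
  exact: (idealM (X_power_ideal _ _)).
have xi0 i : (xi i).[0] = z i.
  rewrite /xi mulr0 add0r hornerD hornerM !hornerC horner_sum big1 ?mulr0 ?addr0 // => j _.
  have [q ->] := wX j.
  by rewrite !hornerM hornerXn expr1 !mulr0.
have relation : \sum_(a' : {ffun 'I_k -> 'I_M}) (\prod_i mmap rho xi (F i) ^+ a' i) * (map_poly rho (P a')).[xi l] = 0.
  have := congr1 (mmap rho xi) cE; rewrite rmorph0 rmorph_sum /= => cE'.
  rewrite -[RHS]cE'; apply: eq_bigr => a' _; rewrite rmorph_sum /=.
  rewrite rmorph_sum horner_sum mulr_sumr; apply: eq_bigr => b _ /=.
  rewrite !mmapM mmap_const rmorph_prod rmorphXn /= mmap_var.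
  rewrite rmorphM rmorphXn /= map_polyC map_polyX hornerM hornerC hornerXn.
  rewrite mulrCA; congr (_ * (_ * _)).
  by apply: eq_bigr => i _; rewrite rmorphXn.
have prodF (a' : {ffun 'I_k -> 'I_M}) : X_power mu.+1 (\prod_i mmap rho xi (F i) ^+ a' i -
    cD e ^+ (2 * \sum_(i < k) a' i) * t ^+ dig a').
  have -> : cD e ^+ (2 * \sum_(i < k) a' i) * t ^+ dig a' = \prod_i Y i ^+ a' i.
    rewrite exprM expr_sum expr_sum -big_split; apply: eq_bigr => i _ /=.
    by rewrite /Y [RHS]exprMn; congr (_ * _); rewrite -exprM mulnC.
  apply: ideal_eq_prod => [|i]; first exact: X_power_ideal.
  by apply: ideal_eq_exp => //; exact: X_power_ideal.
have idX := X_power_ideal D mu.+1.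
have : X_power mu.+1 (cD e ^+ (2 * \sum_(i < k) a i) * t ^+ mu * (map_poly rho (P a)).[xi l]).
  rewrite (bigD1 a) //= in relation.
  have -> : cD e ^+ (2 * \sum_(i < k) a i) * t ^+ mu * (map_poly rho (P a)).[xi l] =
    - ((\prod_i mmap rho xi (F i) ^+ a i - cD e ^+ (2 * \sum_(i < k) a i) * t ^+ dig a)
        * (map_poly rho (P a)).[xi l])
    - \sum_(a' : {ffun 'I_k -> 'I_M} | a' != a) (\prod_i mmap rho xi (F i) ^+ a' i) * (map_poly rho (P a')).[xi l].
    have -> : \sum_(a' : {ffun 'I_k -> 'I_M} | a' != a) (\prod_i mmap rho xi (F i) ^+ a' i) * (map_poly rho (P a')).[xi l]
      = - ((\prod_i mmap rho xi (F i) ^+ a i) * (map_poly rho (P a)).[xi l]).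
      by apply/eqP; rewrite -addr_eq0 addrC relation.
    by rewrite -/mu; ring.
  apply: idealB => //; first by apply: idealN => //; apply: idealMr.
  apply: ideal_sum => // a' neq_a.
  have [->|Pa'] := eqVneq (P a') 0.
    by rewrite rmorph0 horner0 mulr0; apply: (ideal0 idX).
  apply: idealMr => //.
  rewrite -[\prod_i _](subrK (cD e ^+ (2 * \sum_(i < k) a' i) * t ^+ dig a')).
  apply: (idealD idX) => //; apply: (idealM idX).
  have lt_mu : (mu < dig a')%N.
    rewrite ltn_neqAle a_min // andbT; apply: contra neq_a => /eqP eq_dig.
    by apply/eqP/esym/digits_inj.
  by exists (t ^+ (dig a' - mu.+1)); rewrite -exprD subnK.
(* In degree mu this reads e^(2 |a|) P_a(xi_l(0)) = 0, and e is regular. *)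
case=> q /(congr1 (fun p : {poly D} => p`_mu)).
rewrite -rmorphXn -mulrA mulrCA coefXnM coefMXn ltnSn ltnn subnn.
rewrite -horner_coef0 hornerM hornerC => eP.
have {eP}: (map_poly rho (P a)).[xi l].[0] = 0.
  move: eP; elim: (2 * _)%N => [|n IHn]; first by rewrite expr0 mul1r.
  by rewrite exprS -mulrA => /e_reg/IHn.
(* The curve starts at z. *)
have ev0 : (map_poly rho (P a)).[xi l].[0] = horner_eval 0 (map_poly rho (P a)).[xi l] by [].
rewrite ev0 -horner_map -map_poly_comp /= => <-.
have -> : horner_eval 0 (xi l) = z l by exact: xi0.
congr (_.[_]); apply: eq_map_poly => x /=; by rewrite /horner_eval hornerC.
Qed.

(** * Linear algebra over a Henselian local ring *)

Section local.
Variable R : idomainType.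
Hypothesis locR : local_ring R.

Lemma max_ideal_is_ideal : is_ideal (@max_ideal R).
Proof.
split=> [|x y|a x]; rewrite /max_ideal /=.
- by rewrite unitr0.
- exact: locR.
- by rewrite unitrM negb_and => ->; rewrite orbT.
Qed.

Lemma max_ideal_proper : ~ @max_ideal R 1.
Proof. by rewrite /max_ideal /= unitr1. Qed.

Lemma residue_map : exists (K : comNzRingType) (psi : {rmorphism R -> K}),
  forall x, psi x = 0 <-> max_ideal x.
Proof.
have [K [psi [_ psiP]]] := ideal_quotient max_ideal_is_ideal max_ideal_proper.
by exists K, psi.
Qed.

Lemma notin_max_ideal (x : R) : ~ max_ideal x <-> x \is a GRing.unit.
Proof. by rewrite /max_ideal /=; split=> [/negP|->//]; rewrite negbK. Qed.

Lemma unit_congr (x y : R) :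
  max_ideal (x - y) -> y \is a GRing.unit -> x \is a GRing.unit.
Proof.
move=> xy yu; apply/notin_max_ideal => mx.
have : max_ideal (x - (x - y)) by apply: idealB => //; exact: max_ideal_is_ideal.
by rewrite opprB addrC subrK; apply/notin_max_ideal.
Qed.

Lemma det_unit n (M : 'M[R]_n) (b : R) : b \is a GRing.unit ->
  (forall i j, max_ideal (M i j - b *+ (i == j))) -> \det M \is a GRing.unit.
Proof.
move=> bu Mm; apply: (@unit_congr _ (b ^+ n)); last by rewrite unitrX.
have [K [psi psiP]] := residue_map.
apply/psiP; rewrite rmorphB -det_map_mx rmorphXn -det_scalar.
apply/eqP; rewrite subr_eq0; apply/eqP; congr (\det _); apply/matrixP => i j.
by rewrite !mxE; apply/eqP; rewrite -subr_eq0 -rmorphMn -rmorphB; apply/eqP/psiP.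
Qed.

End local.

(** Modulo the maximal ideal, the matrix of multiplication by beta on the
    generators 1, w_i has a single nonzero row.  Its characteristic
    polynomial is then (T - r) T^N modulo the maximal ideal, and the simple
    root lifts: beta is the scalar b.  The w_i solve a linear system whose
    matrix b - B is invertible. *)
Lemma henselian_scalar (R : idomainType) (D : comNzRingType)
    (iota : {rmorphism R -> D}) N (beta : D) (w : 'I_N -> D)
    (r0 : R) (r c : 'I_N -> R) (B : 'I_N -> 'I_N -> R) :
  henselian R -> r0 \is a GRing.unit ->
  beta = iota r0 + \sum_i iota (r i) * w i ->
  (forall i, beta * w i = iota (c i) + \sum_j iota (B i j) * w j) ->
  (forall i, max_ideal (c i)) -> (forall i j, max_ideal (B i j)) ->
  (forall (q : {poly R}) d, q.[r0] \is a GRing.unit ->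
     (map_poly iota q).[beta] * d = 0 -> d = 0) ->
  exists x : 'I_N -> R, forall i, w i = iota (x i) /\ max_ideal (x i).
Proof.
case=> locR hensR r0u beta1 betaw mc mB reg.
have idm := max_ideal_is_ideal locR.
pose M : 'M[R]_(1 + N) := block_mx r0%:M (\row_j r j) (\col_i c i) (\matrix_(i, j) B i j).
pose f := char_poly M.
have fb : (map_poly iota f).[beta] = 0.
  pose W : 'cV[D]_(1 + N) := col_mx 1%:M (\col_i w i).
  have MW : map_mx iota M *m W = beta *: W.
    rewrite map_block_mx mul_block_col scale_col_mx; congr col_mx; apply/matrixP => i j.
      rewrite mulmx1 !mxE !ord1 !eqxx !mulr1n mulr1 beta1; congr (_ + _).
      by apply: eq_bigr => l _; rewrite !mxE.
    rewrite mulmx1 !mxE betaw; congr (_ + _).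
    by apply: eq_bigr => l _; rewrite !mxE.
  have : (map_poly iota f).[beta] *: W = 0.
    rewrite map_char_poly -[_.[_]]/(horner_eval beta _) /char_poly -det_map_mx.
    set E := map_mx _ _.
    have -> : E = beta%:M - map_mx iota M.
      apply/matrixP => i j; rewrite !mxE /= /horner_eval hornerD hornerN hornerC.
      by rewrite hornerMn hornerX.
    rewrite -mul_scalar_mx -mul_adj_mx -mulmxA mulmxBl MW mul_scalar_mx subrr.
    exact: mulmx0.
  by move=> /matrixP/(_ (lshift N ord0) ord0); rewrite mxE col_mxEu !mxE eqxx mulr1.
have [K [psi psiP]] := residue_map locR.
have psif : map_poly psi f = ('X - (psi r0)%:P) * 'X^N.
  rewrite map_char_poly /char_poly.
  have -> : char_poly_mx (map_mx psi M) =
      block_mx ('X - (psi r0)%:P)%:M (- map_mx (polyC \o psi) (\row_j r j)) 0 ('X%:M).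
    rewrite /char_poly_mx [X in X - _]scalar_mx_block /M map_block_mx map_block_mx.
    rewrite opp_block_mx add_block_mx; congr block_mx; apply/matrixP => i j; rewrite !mxE.
    - by rewrite !ord1 eqxx !mulr1n.
    - by rewrite add0r.
    - by rewrite add0r (psiP _).2 ?oppr0.
    - by rewrite (psiP _).2 ?subr0.
  by rewrite det_ublock !det_scalar expr1.
have notm x : x \is a GRing.unit -> psi x <> 0.
  by move=> xu /psiP; apply/notin_max_ideal.
have [||b [fb0 mb]] := hensR f r0 (char_poly_monic _).
- by apply/psiP; rewrite -horner_map psif hornerM hornerXsubC subrr mul0r.
- move/psiP; rewrite -horner_map -deriv_map psif derivM derivXsubC mul1r.
  rewrite hornerD hornerM hornerXsubC subrr mul0r addr0 hornerXn -rmorphXn.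
  by apply: notm; rewrite unitrX.
have [q fq] : exists q, f = q * ('X - b%:P) by apply/factor_theorem/eqP.
have psi_b : psi b = psi r0 by apply/eqP; rewrite -subr_eq0 -rmorphB; apply/eqP/psiP.
have psiq : map_poly psi q = 'X^N.
  apply: (monic_lreg (monicXsubC (psi r0))); rewrite -psif fq rmorphM /= mulrC.
  by rewrite rmorphB /= map_polyX map_polyC /= psi_b.
have betaE : beta = iota b.
  apply/eqP; rewrite -subr_eq0; apply/eqP/(reg q).
    apply/notin_max_ideal => /psiP; rewrite -horner_map psiq hornerXn -rmorphXn.
    by apply: notm; rewrite unitrX.
  by rewrite -fb fq rmorphM rmorphB /= map_polyX map_polyC hornerM hornerXsubC.
have bu : b \is a GRing.unit by apply: (unit_congr locR mb).
pose L : 'M[R]_N := b%:M - \matrix_(i, j) B i j.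
have Lu : \det L \is a GRing.unit.
  apply: (det_unit locR bu) => i j; rewrite !mxE addrAC subrr sub0r.
  exact: idealN.
pose y := invmx L *m \col_i c i.
exists (fun i => y i 0) => i; split; last first.
  by rewrite mxE; apply: ideal_sum => // j _; rewrite [X in _ * X]mxE; apply: (idealM idm).
have LW : map_mx iota L *m (\col_i w i) = map_mx iota (\col_i c i).
  apply/matrixP => {}i j; rewrite map_mxB map_scalar_mx mulmxBl mul_scalar_mx -betaE.
  rewrite !mxE betaw; apply/eqP; rewrite subr_eq; apply/eqP; congr (_ + _).
  by apply: eq_bigr => l _; rewrite !mxE.
have /matrixP/(_ i 0) : \col_i w i = map_mx iota y.
  by rewrite map_mxM -LW mulmxA -map_mxM mulVmx ?unitmxE // map_mx1 mul1mx.
by rewrite [LHS]mxE [RHS]mxE.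
Qed.

(** * Integral elements from algebraic relations *)

Definition divisibility_total (R : comNzRingType) : Prop :=
  forall a b : R, (exists c, b = c * a) \/ (exists c, a = c * b).

(** Divide by a coefficient that divides all the others. *)
Lemma poly_content (R : idomainType) (P : {poly R}) : divisibility_total R -> P != 0 ->
  exists c Q j, [/\ c != 0, P = c *: Q & Q`_j = 1].
Proof.
move=> dvd P0.
have dvd_seq (s : seq R) : exists c, c \in 0 :: s /\ forall x, x \in s -> exists y, x = c * y.
  elim: s => [|a s [c [cs cE]]]; first by exists 0; rewrite inE eqxx.
  have [[y ay]|[y cy]] := dvd a c; last first.
    exists c; split; first by move: cs; rewrite !inE => /orP[->|->]; rewrite ?orbT.
    by move=> x; rewrite inE => /predU1P[->|/cE//]; exists y; rewrite mulrC.
  exists a; split=> [|x]; first by rewrite !inE eqxx orbT.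
  rewrite inE => /predU1P[->|/cE[u ->]]; first by exists 1; rewrite mulr1.
  by exists (y * u); rewrite ay; ring.
have [c [cP cE]] := dvd_seq P.
have lcP : lead_coef P \in (P : seq R).
  by apply: mem_nth; rewrite prednK // lt0n size_poly_eq0.
have c0 : c != 0.
  apply: contraNneq P0 => c0; have [y] := cE _ lcP.
  by rewrite c0 mul0r -lead_coef_eq0 => ->.
have /choice[q qE] : forall i, exists y, P`_i = c * y.
  move=> i; have [lt_i|ge_i] := ltnP i (size P); first exact/cE/mem_nth.
  by exists 0; rewrite nth_default // mulr0.
have PE : P = c *: \poly_(i < size P) q i.
  apply/polyP => i; rewrite coefZ coef_poly; case: ltnP => // ge_i.
  by rewrite nth_default // mulr0.
move: cP; rewrite inE (negPf c0) => /(nthP 0)[j lt_j jE].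
exists c, (\poly_(i < size P) q i), j; split=> //.
rewrite coef_poly lt_j; apply: (mulfI c0); by rewrite -qE jE mulr1.
Qed.

(** With P = a_0 + a_1 T + .. and the truncation s = a_j + a_(j+1) z + .., the
    product s z^n is of degree below d in z as it stands if n < j; if j <= n,
    the relation P(z) = 0 rewrites s z^j as - (a_0 + .. + a_(j-1) z^(j-1)).
    Therefore s and s z are integral over R. *)
Lemma truncation_bounded (R D : comNzRingType) (iota : {rmorphism R -> D})
    (P : {poly R}) (z : D) d j n :
  (size P <= d.+1)%N -> (map_poly iota P).[z] = 0 -> (n <= d)%N ->
  exists2 Q : {poly R}, (size Q <= d)%N &
    (map_poly iota (drop_poly j P)).[z] * z ^+ n = (map_poly iota Q).[z].
Proof.
move=> sP Pz le_nd; have [lt_nj|le_jn] := ltnP n j.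
  exists (drop_poly j P * 'X^n).
    apply: leq_trans (size_polyMleq _ _) _; rewrite size_polyXn size_drop_poly. by move: sP; case: (size P) => [|m]; lia.
  by rewrite rmorphM /= map_polyXn hornerM hornerXn.
exists (- (take_poly j P * 'X^(n - j))).
  rewrite size_polyN; apply: leq_trans (size_polyMleq _ _) _; rewrite size_polyXn.
  by move: (size_take_poly j P); case: (size _) => [|m]; lia.
move: Pz; rewrite -{1}(poly_take_drop j P) rmorphD rmorphM /= map_polyXn.
rewrite hornerD hornerM hornerXn => /eqP; rewrite addrC addr_eq0 => /eqP Pz.
rewrite -{1}(subnK le_jn) addnC exprD mulrA Pz rmorphN rmorphM /= map_polyXn.
by rewrite hornerN hornerM hornerXn mulNr.
Qed.

Section bounded_monomials.
Variables (R D : comNzRingType) (iota : {rmorphism R -> D}) (k d : nat) (z : 'I_k -> D).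

Local Notation exponent := {ffun 'I_k -> 'I_d}.

Let mon (a : exponent) : D := \prod_i z i ^+ a i.

Definition monomial_span (I : R -> Prop) (x : D) : Prop :=
  exists r : exponent -> R, (forall a, I (r a)) /\ x = \sum_a iota (r a) * mon a.

Definition multiplies_span (I : R -> Prop) (x : D) : Prop :=
  forall y, monomial_span (fun=> True) y -> monomial_span I (x * y).

Variable I : R -> Prop.
Hypothesis idI : is_ideal I.

Let spanD x y : monomial_span I x -> monomial_span I y -> monomial_span I (x + y).
Proof.
move=> [r [Ir ->]] [s [Is ->]]; exists (fun a => r a + s a); split.
  by move=> a; apply: (idealD idI).
by rewrite -big_split; apply: eq_bigr => a _; rewrite rmorphD mulrDl.
Qed.

Lemma monomial_span_sum (J : finType) (f : J -> D) :
  (forall j, monomial_span I (f j)) -> monomial_span I (\sum_j f j).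
Proof.
move=> If; apply: big_ind => [|x y xI yI|j _]; [|exact: spanD|exact: If].
exists (fun=> 0); split=> [a|]; first exact: (ideal0 idI).
by rewrite big1 // => a _; rewrite rmorph0 mul0r.
Qed.

Lemma monomial_span_scale c x :
  monomial_span I x -> monomial_span I (iota c * x).
Proof.
case=> r [Ir ->]; exists (fun a => c * r a); split=> [a|].
  exact: (idealM idI).
by rewrite mulr_sumr; apply: eq_bigr => a _; rewrite rmorphM mulrA.
Qed.

Lemma monomial_span_mem a : I 1 -> monomial_span I (mon a).
Proof.
move=> I1; exists (fun b => (b == a)%:R); split=> [b|].
  by rewrite -[_%:R]mulr1; apply: (idealM idI).
rewrite (bigD1 a) //= eqxx rmorph1 mul1r big1 ?addr0 // => b /negPf ->.
by rewrite rmorph0 mul0r.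
Qed.

Lemma multiplies_spanP x :
  (forall a, monomial_span I (x * mon a)) -> multiplies_span I x.
Proof.
move=> xa _ [r [_ ->]]; rewrite mulr_sumr; apply: monomial_span_sum => a.
by rewrite mulrCA; apply: monomial_span_scale.
Qed.

Lemma multiplies_spanD x y :
  multiplies_span I x -> multiplies_span I y -> multiplies_span I (x + y).
Proof. by move=> xI yI w wW; rewrite mulrDl; apply: spanD; [apply: xI|apply: yI]. Qed.

Lemma multiplies_spanM x y : multiplies_span I x ->
  multiplies_span (fun=> True) y -> multiplies_span I (x * y).
Proof. by move=> xI yT w wW; rewrite -mulrA; apply/xI/yT. Qed.

Lemma multiplies_span_iota c x : I c ->
  multiplies_span (fun=> True) x -> multiplies_span I (iota c * x).
Proof.
move=> Ic xT w wW; rewrite -mulrA; have [r [_ ->]] := xT w wW.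
exists (fun a => c * r a); split=> [a|]; first exact: idealMr.
by rewrite mulr_sumr; apply: eq_bigr => a _; rewrite rmorphM mulrA.
Qed.
End bounded_monomials.

Lemma ideal_all (R : comNzRingType) : is_ideal (fun _ : R => True).
Proof. by split. Qed.

Lemma truncation_multiplies (R D : comNzRingType) (iota : {rmorphism R -> D}) k d
    (z : 'I_k -> D) (P : {poly R}) i j :
  (size P <= d.+1)%N -> (map_poly iota P).[z i] = 0 ->
  let s := (map_poly iota (drop_poly j P)).[z i] in
  multiplies_span iota d z (fun=> True) s /\
  multiplies_span iota d z (fun=> True) (s * z i).
Proof.
move=> sP Pz s.
suff key n (a : {ffun 'I_k -> 'I_d}) : (n <= d)%N ->
    monomial_span iota d z (fun=> True) (s * z i ^+ n * \prod_(l | l != i) z l ^+ a l).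
  split; apply: (multiplies_spanP (ideal_all R)) => a; rewrite (bigD1 i) //= mulrA.
    by apply: key; apply: ltnW.
  by rewrite -[s * z i * _]mulrA -exprS; apply: key.
move=> le_nd; have [Q sQ ->] := truncation_bounded j sP Pz le_nd.
rewrite (horner_coef_wide (n := d)); last by rewrite (leq_trans (size_poly _ _)).
rewrite mulr_suml; apply: (monomial_span_sum (ideal_all R)) => m.
rewrite coef_map -mulrA; apply: (monomial_span_scale (ideal_all R)).
pose b : {ffun 'I_k -> 'I_d} := [ffun l => if l == i then m else a l].
have -> : z i ^+ m * \prod_(l | l != i) z l ^+ a l = \prod_l z l ^+ b l.
  rewrite [RHS](bigD1 i) //= ffunE eqxx; congr (_ * _).
  by apply: eq_bigr => l /negPf nl; rewrite ffunE nl.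
exact: (monomial_span_mem iota z (ideal_all R)).
Qed.

(** * The germ of a solution is rational *)

Section rational_point.
Variables (R : idomainType) (D : comNzRingType) (k : nat).
Variable pi : {rmorphism mpoly k R -> D}.

Let iota : {rmorphism R -> D} := pi \o @mpolyC k R.
Let z (i : 'I_k) : D := pi (mpolyX R (mnm1 i)).

Hypothesis henR : henselian R.
Hypothesis pi_ker : forall f, pi f = 0 -> max_ideal (meval (fun=> 0) f).
Hypothesis pi_reg : forall f d,
  meval (fun=> 0) f \is a GRing.unit -> pi f * d = 0 -> d = 0.
Hypothesis algebraic : forall i, exists (P : {poly R}) j,
  P`_j \is a GRing.unit /\ (map_poly iota P).[z i] = 0.
Variables (g : mpoly k R) (c : 'I_k -> R) (q : 'I_k -> 'I_k -> mpoly k R).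
Hypothesis g_unit : meval (fun=> 0) g \is a GRing.unit.
Hypothesis c_small : forall j, max_ideal (c j).
Hypothesis g_small : forall l, pi g * z l = \sum_j iota (c j) * pi (q l j).

Let pi_horner (Q : {poly R}) (f : mpoly k R) :
  (map_poly iota Q).[pi f] = pi (map_poly (@mpolyC k R) Q).[f].
Proof. by rewrite -horner_map -map_poly_comp. Qed.

Let meval_horner (Q : {poly R}) (f : mpoly k R) :
  meval (fun=> 0) (map_poly (@mpolyC k R) Q).[f] = Q.[meval (fun=> 0) f].
Proof.
rewrite -horner_map -map_poly_comp map_poly_id // => x _ /=; exact: mevalC.
Qed.

(** Let s be the product of the truncations of the algebraic relations.  As s
    and all s z_i preserve the module W of bounded monomials, so does a high
    power of s times any given element.  Hence beta = s^M g preserves W, and it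
    maps every monomial other than 1 into m W because g z_l lies in m D; this
    is the situation of henselian_scalar. *)
Lemma rational_point : exists x : 'I_k -> R,
  forall i, z i = iota (x i) /\ max_ideal (x i).
Proof.
have [locR _] := henR; have idm := max_ideal_is_ideal locR.
have idT := ideal_all R.
have /choice[Pj PjP] : forall i, exists Pj : {poly R} * nat,
    Pj.1`_Pj.2 \is a GRing.unit /\ (map_poly iota Pj.1).[z i] = 0.
  by move=> i; have [P [j Pj]] := algebraic i; exists (P, j).
pose d := (\sum_i size (Pj i).1).+1.
have size_P i : (size (Pj i).1 <= d.+2)%N.
  by rewrite /d (bigD1 i) //=; lia.
pose T := {ffun 'I_k -> 'I_d.+1}.
pose mon (a : T) : D := \prod_i z i ^+ a i.
pose W I x := @monomial_span R D iota k d.+1 z I x.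
pose acts I x := @multiplies_span R D iota k d.+1 z I x.
pose top := fun _ : R => True.
pose S i := drop_poly (Pj i).2 (Pj i).1.
pose s' i : mpoly k R := (map_poly (@mpolyC k R) (S i)).[mpolyX R (mnm1 i)].
pose s : mpoly k R := \prod_i s' i.
have s0 : meval (fun=> 0) s \is a GRing.unit.
  rewrite rmorph_prod rpred_prod // => i _ /=.
  rewrite meval_horner mevalXU horner_coef0 coef_drop_poly add0n.
  by case: (PjP i).
have acts1 : acts top 1 by move=> y; rewrite mul1r.
have s'_acts i : acts top (pi (s' i)) /\ acts top (pi (s' i) * z i).
  have [_ Pz] := PjP i; rewrite -pi_horner.
  exact: (truncation_multiplies (Pj i).2 (size_P i) Pz).
have s_acts (Q : pred 'I_k) : acts top (\prod_(i | Q i) pi (s' i)).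
  apply: big_ind => // [x y|i _]; last by case: (s'_acts i).
  exact: multiplies_spanM.
have sz_acts l : acts top (pi s * z l).
  rewrite rmorph_prod (bigD1 l) //= mulrAC.
  by apply: multiplies_spanM; [case: (s'_acts l)|exact: s_acts].
have sX_acts n : acts top (pi s ^+ n).
  elim: n => [|n IHn]; first by rewrite expr0.
  rewrite exprS; apply: multiplies_spanM; last exact: IHn.
  by rewrite rmorph_prod; apply: s_acts.
have big_power f : exists M0, forall M, (M0 <= M)%N -> acts top (pi s ^+ M * pi f).
  elim/mpoly_ind: f => [a|i|f1 f2 [M1 f1M] [M2 f2M]|f1 f2 [M1 f1M] [M2 f2M]].
  - exists 0%N => M _; rewrite mulrC -[pi (mpolyC k a)]/(iota a).
    exact: (@multiplies_span_iota R D iota k d.+1 z top idT a _ Logic.I (sX_acts M)).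


  - exists 1%N => -[//|M] _; rewrite exprSr -mulrA.
    by apply: multiplies_spanM; [exact: sX_acts|exact: sz_acts].
  - exists (M1 + M2)%N => M le_M; rewrite rmorphD mulrDr.
    by apply: (multiplies_spanD idT); [apply: f1M|apply: f2M]; lia.
  - exists (M1 + M2)%N => M le_M; rewrite rmorphM.
    have -> : pi s ^+ M * (pi f1 * pi f2) = (pi s ^+ M1 * pi f1) * (pi s ^+ (M - M1) * pi f2).
      rewrite -[in LHS](subnKC (_ : M1 <= M)%N) ?exprD; last by lia.
      by ring.
    by apply: multiplies_spanM; [apply: f1M|apply: f2M; lia].
have [Mg gM] := big_power g.
have /choice[Mq qM] : forall lj, exists M0, forall M, (M0 <= M)%N ->
    acts top (pi s ^+ M * pi (q lj.1 lj.2)) by move=> lj; apply: big_power.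
pose M := (Mg + \sum_lj Mq lj)%N.
pose bh := s ^+ M * g; pose beta := pi bh.
have betaE : beta = pi s ^+ M * pi g by rewrite /beta /bh rmorphM rmorphXn.
have bh0 : meval (fun=> 0) bh \is a GRing.unit.
  by rewrite mevalM rmorphXn unitrM g_unit andbT unitrX.
have beta_z l : acts (@max_ideal R) (beta * z l).
  rewrite betaE -mulrA g_small mulr_sumr; apply: big_ind => [|x y|j _].
  - by move=> y _; rewrite mul0r; exists (fun=> 0); split=> [*|];
      [apply: (ideal0 idm)|rewrite big1 // => a _; rewrite rmorph0 mul0r].
  - exact: (multiplies_spanD idm).
  - rewrite mulrCA; apply: (multiplies_span_iota idm) => //.
    apply: (qM (l, j)); rewrite /M (bigD1 (l, j)) //=; lia.
pose a0 : T := [ffun=> ord0].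
have mon0 : mon a0 = 1 by rewrite /mon big1 // => i _; rewrite ffunE expr0.
(* The generator 1 is kept apart; zero takes its place in the enumeration. *)
pose w (i : 'I_#|T|) : D := if enum_val i == a0 then 0 else mon (enum_val i).
have W_w I x : W I x -> exists (c0 : R) (r : 'I_#|T| -> R),
    [/\ I c0, forall i, I (r i) & x = iota c0 + \sum_i iota (r i) * w i].
  case=> r [Ir ->]; exists (r a0), (fun i => r (enum_val i)); split=> //.
  rewrite (bigD1 a0) //= -/(mon a0) mon0 mulr1; congr (_ + _).
  transitivity (\sum_(a : T) iota (r a) * (if a == a0 then 0 else mon a)).
    rewrite [RHS](bigD1 a0) //= eqxx mulr0 add0r; apply: eq_bigr => a /negPf na.
    by rewrite na.
  by rewrite (reindex (@enum_val T T)) //; apply: (onW_bij _ (enum_val_bij _)).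
have [r0 [r [_ _ beta1]]] : exists (c0 : R) (r : 'I_#|T| -> R),
    [/\ top c0, forall i, top (r i) & beta = iota c0 + \sum_i iota (r i) * w i].
  apply: W_w; rewrite -[beta]mulr1 -mon0 betaE; apply: gM; first by rewrite /M; lia.
  exact: (monomial_span_mem iota z (ideal_all R)).
have /choice[cB cBP] : forall i, exists cB : R * ('I_#|T| -> R),
    [/\ max_ideal cB.1, forall j, max_ideal (cB.2 j) &
        beta * w i = iota cB.1 + \sum_j iota (cB.2 j) * w j].
  move=> i; suff [c0 [r' [? ? ?]]] : exists (c0 : R) (r : 'I_#|T| -> R),
      [/\ max_ideal c0, forall j, max_ideal (r j) &
          beta * w i = iota c0 + \sum_j iota (r j) * w j].
    by exists (c0, r').
  rewrite {1}/w; case: eqVneq => [_|na0].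
    exists 0, (fun=> 0); split=> [|*|]; [exact: (ideal0 idm)|exact: (ideal0 idm)|].
    by rewrite mulr0 (rmorph0 iota) add0r big1 // => j _; rewrite mul0r.
  set a := enum_val i in na0 *; apply: W_w.
  have [l al] : exists l, (a l : nat) != 0%N.
    apply: contrapT => na; move/eqP: na0; apply; apply/ffunP => l.
    apply/val_inj/eqP; rewrite ffunE /=; apply/negPn/negP => al.
    by apply: na; exists l.
  pose a' : T := [ffun j => if j == l then inord (a l).-1 else a j].
  have -> : mon a = z l * mon a'.
    rewrite /mon (bigD1 l) // [X in _ = _ * X](bigD1 l) //= mulrA ffunE eqxx inordK.
      rewrite -exprS prednK ?lt0n //; congr (_ * _).
      by apply: eq_bigr => j /negPf nj; rewrite ffunE nj.
    by have := ltn_ord (a l); lia.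
  rewrite mulrA; apply: beta_z; exact: (monomial_span_mem iota z (ideal_all R)).
pose wh (i : 'I_#|T|) : mpoly k R := if enum_val i == a0 then 0
  else \prod_l (mpolyX R (mnm1 l)) ^+ (enum_val i l).
have wE i : w i = pi (wh i).
  rewrite /w /wh; case: eqP => _; first by rewrite rmorph0.
  by rewrite rmorph_prod; apply: eq_bigr => l _; rewrite rmorphXn.
have wh0 i : meval (fun=> 0) (wh i) = 0.
  rewrite /wh; case: eqVneq => [_|na0]; first exact: meval0.
  have [l al] : exists l, (enum_val i l : nat) != 0%N.
    apply: contrapT => na; move/eqP: na0; apply; apply/ffunP => l.
    apply/val_inj/eqP; rewrite ffunE /=; apply/negPn/negP => al.
    by apply: na; exists l.
  rewrite rmorph_prod (bigD1 l) //= rmorphXn /= mevalXU expr0n.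
  by rewrite (negPf al) mul0r.
(* Comparing constant terms: r0 is a unit because s and g are units at 0. *)
have r0_bh : max_ideal (meval (fun=> 0) bh - r0).
  have : pi (bh - (mpolyC k r0 + \sum_i mpolyC k (r i) * wh i)) = 0.
    rewrite rmorphB rmorphD rmorph_sum /= -/beta {1}beta1 opprD addrACA subrr add0r.
    apply/eqP; rewrite subr_eq0; apply/eqP/eq_bigr => i _.
    by rewrite wE rmorphM.
  move/pi_ker; rewrite mevalB mevalD mevalC raddf_sum big1 ?addr0 // => i _ /=.
  by rewrite mevalM wh0 mulr0.
have r0u : r0 \is a GRing.unit.
  by apply: (unit_congr locR) bh0; rewrite -opprB; apply: idealN.
have bw i : beta * w i = iota (cB i).1 + \sum_j iota ((cB i).2 j) * w j.
  by case: (cBP i).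
have [|||x xP] := henselian_scalar henR r0u beta1 bw.
- by move=> i; case: (cBP i).
- by move=> i j; case: (cBP i).
- move=> Q y Qu; rewrite pi_horner; apply: pi_reg; rewrite meval_horner.
  apply: (unit_congr locR) Qu; have [K [psi psiP]] := residue_map locR.
  apply/psiP; rewrite rmorphB -!horner_map.
  suff -> : psi (meval (fun=> 0) bh) = psi r0 by rewrite subrr.
  by apply/eqP; rewrite -subr_eq0 -rmorphB; apply/eqP/psiP.
pose e (l : 'I_k) : T := [ffun j => inord (j == l)].
have eE l j : e l j = (j == l) :> nat.
  by rewrite ffunE inordK //; case: (j == l).
exists (fun l => x (enum_rank (e l))) => l; suff -> : z l = w (enum_rank (e l)) by apply: xP.
rewrite /w enum_rankK ifN; last first.
  apply/eqP => /ffunP/(_ l)/(congr1 (fun m : 'I_d.+1 => m : nat)).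
  by rewrite eE eqxx ffunE.
rewrite /mon (bigD1 l) //= eE eqxx expr1 big1 ?mulr1 // => j /negPf nj.
by rewrite eE nj expr0.
Qed.
End rational_point.

(** * The multivariate Hensel lemma *)

Lemma mmap_mpolyX (A : comNzRingType) n (p : mpoly n A) :
  mmap (@mpolyC n A) (fun i => mpolyX A (mnm1 i)) p = p.
Proof.
elim/mpoly_ind: p => [c|i|p q pE qE|p q pE qE].
- exact: mmap_const.
- exact: mmap_var.
- by rewrite mmapD pE qE.
- by rewrite mmapM pE qE.
Qed.

Lemma taylor0 (A : comNzRingType) n (p : mpoly n A) :
  exists N : 'I_n -> mpoly n A,
    p = mpolyC n (meval (fun=> 0) p) + \sum_l mpolyX A (mnm1 l) * N l /\
    forall l, meval (fun=> 0) (N l) = meval (fun=> 0) (mderiv l p).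
Proof.
have [//|//|//|s [_]] := @taylor A (mpoly n A) (@mpolyC n A) n _ (fun=> 0)
  (fun i => mpolyX A (mnm1 i)) p (subringT (mpoly n A)).
have ev q : mmap (@mpolyC n A) (fun=> 0) q = mpolyC n (meval (fun=> 0) q).
  by apply/esym/rmorph_mmap => // i; rewrite rmorph0.
rewrite (eq_mmap _ (b := fun i => mpolyX A (mnm1 i))) => [|i]; last by rewrite add0r.
rewrite mmap_mpolyX ev => pE.
exists (fun l => mpolyC n (meval (fun=> 0) (mderiv l p)) + \sum_j mpolyX A (mnm1 j) * s l j).
split=> [|l].
  rewrite {1}pE -addrA -big_split; congr (_ + _); apply: eq_bigr => l _ /=.
  rewrite mulrDr ev; congr (_ + _); rewrite mulr_sumr; apply: eq_bigr => j _; ring.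
rewrite mevalD mevalC [X in _ + X]raddf_sum [X in _ + X]big1 ?addr0 // => j _ /=.
by rewrite mevalM mevalXU mul0r.
Qed.

(** D is the ring of germs at the origin of the zero scheme of X - G, with the
    torsion over R divided out; it is nonzero by fixpoint_torsion_free. *)
Lemma fixpoint_germs (R : idomainType) k (G : 'I_k -> mpoly k R) :
  local_ring R ->
  (forall i, max_ideal (meval (fun=> 0) (G i))) ->
  (forall i l, max_ideal (meval (fun=> 0) (mderiv l (G i)))) ->
  exists (D : comNzRingType) (pi : {rmorphism mpoly k R -> D}),
    [/\ forall i, pi (mpolyX R (mnm1 i)) = pi (G i),
        forall f, pi f = 0 -> max_ideal (meval (fun=> 0) f),
        forall f d, meval (fun=> 0) f \is a GRing.unit -> pi f * d = 0 -> d = 0 &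
        forall c d, c != 0 -> pi (mpolyC k c) * d = 0 -> d = 0].
Proof.
move=> locR G0 dG; have idm := max_ideal_is_ideal locR.
pose I f := exists (c : R) (g : mpoly k R) (h : 'I_k -> mpoly k R),
  [/\ c != 0, meval (fun=> 0) g = 1 &
      mpolyC k c * g * f = \sum_i h i * (mpolyX R (mnm1 i) - G i)].
have idI : is_ideal I.
  split=> [|f f' [c [g [h [c0 g1 E]]]] [c' [g' [h' [c0' g1' E']]]]|a f [c [g [h [c0 g1 E]]]]].
  - exists 1, 1, (fun=> 0); rewrite oner_neq0 meval1; split=> //.
    by rewrite mulr0 big1 // => i _; rewrite mul0r.
  - exists (c * c'), (g * g'), (fun i => mpolyC k c' * g' * h i + mpolyC k c * g * h' i).
    rewrite mulf_neq0 // mevalM g1 g1' mulr1; split=> //.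
    transitivity (mpolyC k c' * g' * (mpolyC k c * g * f)
                + mpolyC k c * g * (mpolyC k c' * g' * f')).
      by rewrite rmorphM /=; ring.
    rewrite E E' !mulr_sumr -big_split; apply: eq_bigr => i _ /=; ring.
  - exists c, g, (fun i => a * h i); split=> //.
    rewrite mulrCA E mulr_sumr; apply: eq_bigr => i _; ring.
have I_unit f q : meval (fun=> 0) f \is a GRing.unit -> I (f * q) -> I q.
  move=> fu [c [g [h [c0 g1 E]]]].
  exists c, (mpolyC k (meval (fun=> 0) f)^-1 * f * g),
    (fun i => mpolyC k (meval (fun=> 0) f)^-1 * h i).
  rewrite !mevalM mevalC g1 mulr1 mulVr //; split=> //.
  transitivity (mpolyC k (meval (fun=> 0) f)^-1 * (mpolyC k c * g * (f * q))); first by ring.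
  by rewrite E mulr_sumr; apply: eq_bigr => i _; ring.
have I1 : ~ I 1.
  case=> c [g [h [c0 g1]]]; rewrite mulr1 => E; move: c0.
  by rewrite (fixpoint_torsion_free idm (@max_ideal_proper R) G0 dG g1 E) eqxx.
have [D [pi [surj piI]]] := ideal_quotient idI I1.
exists D, pi; split=> [i|f|f d fu|c d c0].
- apply/eqP; rewrite -subr_eq0 -rmorphB; apply/eqP/piI.
  exists 1, 1, (fun j => (j == i)%:R); rewrite oner_neq0 meval1; split=> //.
  rewrite rmorph1 !mul1r (bigD1 i) //= eqxx mul1r big1 ?addr0 // => j /negPf ->.
  by rewrite mul0r.
- move/piI => If; apply: contrapT => /notin_max_ideal fu.
  by apply: I1; apply: (I_unit f) => //; rewrite mulr1.
- have [q <-] := surj d; rewrite -rmorphM => /piI fq; apply/piI.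
  exact: I_unit fq.
- have [q <-] := surj d; rewrite -rmorphM => /piI[c' [g [h [c0' g1 E]]]]; apply/piI.
  exists (c' * c), g, h; split=> //; first exact: mulf_neq0.
  by rewrite -E rmorphM /=; ring.
Qed.

(** The coordinates of the tautological solution in the ring of germs come from R
    by rational_point, and R embeds in the ring of germs. *)
Lemma multivariate_hensel (R : idomainType) k (G : 'I_k -> mpoly k R) :
  henselian R -> divisibility_total R ->
  (forall i, max_ideal (meval (fun=> 0) (G i))) ->
  (forall i l, max_ideal (meval (fun=> 0) (mderiv l (G i)))) ->
  exists x : 'I_k -> R, forall i, max_ideal (x i) /\ x i = meval x (G i).
Proof.
move=> henR dvd G0 dG; have [locR _] := henR; have idm := max_ideal_is_ideal locR.
have [D [pi [piG pi_ker pi_reg pi_tf]]] := fixpoint_germs locR G0 dG.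
pose iota : {rmorphism R -> D} := pi \o @mpolyC k R.
pose z i := pi (mpolyX R (mnm1 i)).
have iota0 x : iota x = 0 -> x = 0.
  move=> ix; apply/eqP/negPn/negP => x0.
  have := pi_tf x 1 x0; rewrite mulr1 => /(_ ix)/eqP; by rewrite oner_eq0.
have mmapz p : mmap iota z p = pi p.
  by rewrite -[in RHS](mmap_mpolyX p); apply/esym/rmorph_mmap.
pose F i := mpolyX R (mnm1 i) - G i.
have Fz i : mmap iota z (F i) = 0 by rewrite mmapz rmorphB /= piG subrr.
have dF0 i j : max_ideal (meval (fun=> 0) (mderiv j (F i)) - 1 *+ (i == j)).
  rewrite mderivB mevalB mderiv_var mevalC addrAC subrr sub0r.
  exact: idealN.
have J_reg d : \det (\matrix_(i, j) mmap iota z (mderiv j (F i))) * d = 0 -> d = 0.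
  pose J : 'M[mpoly k R]_k := \matrix_(i, j) mderiv j (F i).
  have -> : \matrix_(i, j) mmap iota z (mderiv j (F i)) = map_mx pi J.
    by apply/matrixP => i j; rewrite !mxE mmapz.
  rewrite det_map_mx; apply: pi_reg; rewrite -det_map_mx.
  apply: (det_unit locR (unitr1 R)) => i j; rewrite !mxE; exact: dF0.
have /choice[N NP] : forall i, exists N : 'I_k -> mpoly k R,
    G i = mpolyC k (meval (fun=> 0) (G i)) + \sum_l mpolyX R (mnm1 l) * N l /\
    forall l, meval (fun=> 0) (N l) = meval (fun=> 0) (mderiv l (G i)).
  by move=> i; apply: taylor0.
(* Write G(X) = G(0) + N X.  Then (1 - N) z = G(0), so that det (1 - N) maps z
   into the ideal generated by the G_i(0). *)
pose L : 'M[mpoly k R]_k := 1%:M - \matrix_(i, j) N i j.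
have [|||x xP] := @rational_point R D k pi henR pi_ker pi_reg _ (\det L)
   (fun j => meval (fun=> 0) (G j)) (fun l j => (\adj L) l j) _ G0.
- move=> i; have [P P0 Pz] := nonsingular_zero_algebraic i Fz J_reg.
  have [c [Q [j [c0 PE Qj]]]] := poly_content dvd P0.
  exists Q, j; rewrite Qj unitr1; split=> //.
  apply: (pi_tf c) => //; rewrite -[X in _ = X]Pz PE.
  by rewrite map_polyZ hornerZ.
- rewrite -det_map_mx; apply: (det_unit locR (unitr1 R)) => i j.
  have [_ N0] := NP i.
  rewrite !mxE /= mevalB rmorph_nat N0 addrAC subrr sub0r.
  exact: idealN.
- move=> l; rewrite -rmorphM -[\det L * _]/((\det L * mpolyX R (mnm1 l))).
  pose X : 'cV[mpoly k R]_k := \col_i mpolyX R (mnm1 i).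
  have LX i : (L *m X) i 0 = F i + mpolyC k (meval (fun=> 0) (G i)).
    have [GE _] := NP i; rewrite /F; set c0 := mpolyC k _ in GE *; rewrite GE.
    rewrite mulmxBl mul1mx !mxE.
    under eq_bigr => j _ do rewrite !mxE mulrC.
    by ring.
  have -> : \det L * mpolyX R (mnm1 l) = (\adj L *m (L *m X)) l 0.
    by rewrite mulmxA mul_adj_mx mul_scalar_mx !mxE.
  rewrite mxE rmorph_sum; apply: eq_bigr => j _ /=.
  rewrite LX rmorphM rmorphD /F rmorphB /= piG subrr add0r mulrC.
  by [].
exists x => i; have [zE mx] := xP i; split=> //.
apply/eqP; rewrite -subr_eq0; apply/eqP/iota0; rewrite rmorphB /=.
have zx j : z j = iota (x j) by case: (xP j).
have -> : pi (mpolyC k (meval x (G i))) = mmap iota z (G i).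
  by apply: (@rmorph_mmap _ _ _ _ idfun iota) => // j; rewrite zx.
by rewrite mmapz -piG -[pi (mpolyX _ _)]/(z i) zx subrr.
Qed.

(** * Balls of a valuation ring *)

Section valuation_balls.
Variables (R : idomainType) (G : porderZmodType) (v : {fraction R} -> G).
Hypothesis vR : valuation_ring v.

Definition valuation_ball (g : G) (x : R) : Prop := x = 0 \/ g < v (tofrac x).

Let valv : valuation v := vR.1.
Let ogG : ordered_group G := val_group valv.

Let leD2l (z x y : G) : (z + x <= z + y) = (x <= y).
Proof.
apply/idP/idP => [|/(og_leD ogG z)//].
by move/(og_leD ogG (- z)); rewrite !addKr.
Qed.

Let ltD2l (z x y : G) : (z + x < z + y) = (x < y).
Proof. by rewrite !lt_neqAle leD2l (inj_eq (addrI z)). Qed.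

Let leNgt (x y : G) : (x <= y) = ~~ (y < x).
Proof.
apply/idP/idP => [xy|]; first by apply/negP => /(le_lt_trans xy); rewrite ltxx.
by have /orP[//|yx] := og_total ogG x y; rewrite lt_neqAle yx andbT negbK => /eqP ->.
Qed.

Let tofrac_neq0 (x : R) : x != 0 -> tofrac x != 0.
Proof. by rewrite tofrac_eq0. Qed.

Let v1 : v 1 = 0.
Proof.
apply: (addrI (v 1)); rewrite addr0 -(Defs.valM valv) ?oner_neq0 //.
by rewrite mulr1.
Qed.

Let vV x : x != 0 -> v x^-1 = - v x.
Proof.
move=> x0; apply: (addrI (v x)); rewrite subrr -(Defs.valM valv) ?invr_neq0 //.
by rewrite divff.
Qed.

Let vge0 (a : R) : a != 0 -> 0 <= v (tofrac a).
Proof.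
move=> a0; have [|a0'|//] := (vR.2 (tofrac a)).1; first by exists a.
by move: (tofrac_neq0 a0); rewrite a0' eqxx.
Qed.

Let dvd_of_le (a b : R) : a != 0 -> b != 0 -> v (tofrac a) <= v (tofrac b) ->
  exists c, b = c * a /\ v (tofrac c) = v (tofrac b) - v (tofrac a).
Proof.
move=> a0 b0 ab; have ta := tofrac_neq0 a0; have tb := tofrac_neq0 b0.
have vba : v (tofrac b / tofrac a) = v (tofrac b) - v (tofrac a).
  by rewrite (Defs.valM valv) ?invr_neq0 // vV.
have [|c cE] := (vR.2 (tofrac b / tofrac a)).2.
  by right; rewrite vba -(leD2l (v (tofrac a))) addr0 addrC subrK.
exists c; rewrite -cE vba; split=> //.
by apply/eqP; rewrite -tofrac_eq tofracM -cE divfK.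
Qed.

Lemma valuation_ring_divisibility : divisibility_total R.
Proof.
move=> a b; have [->|a0] := eqVneq a 0; first by right; exists 0; rewrite mul0r.
have [->|b0] := eqVneq b 0; first by left; exists 0; rewrite mul0r.
have /orP[/(dvd_of_le a0 b0)|/(dvd_of_le b0 a0)] :=
  og_total ogG (v (tofrac a)) (v (tofrac b)) => -[c [cE _]]; [left|right]; by exists c.
Qed.


Lemma valuation_ball_is_ideal g : is_ideal (valuation_ball g).
Proof.
split=> [|x y xg yg|a x xg].
- by left.
- have [x0|x0] := eqVneq x 0; first by rewrite x0 add0r.
  have [y0|y0] := eqVneq y 0; first by rewrite y0 addr0.
  have [xy0|xy0] := eqVneq (x + y) 0; first by left.
  case: xg => [x0'|xg]; first by rewrite x0' eqxx in x0.
  case: yg => [y0'|yg]; first by rewrite y0' eqxx in y0.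
  right; apply: (lt_le_trans (y := Order.min (v (tofrac x)) (v (tofrac y)))).
    by rewrite minElt; case: ifP.
  rewrite tofracD; apply: (Defs.valD valv); rewrite ?tofrac_neq0 // -tofracD.
  exact: tofrac_neq0.
- have [->|a0] := eqVneq a 0; first by left; rewrite mul0r.
  case: xg => [->|xg]; first by left; rewrite mulr0.
  have [->|x0] := eqVneq x 0; first by left; rewrite mulr0.
  right; rewrite tofracM (Defs.valM valv) ?tofrac_neq0 //; apply: (lt_le_trans xg).
  by rewrite addrC -{1}[v (tofrac x)]addr0 leD2l vge0.
Qed.

Lemma valuation_ball_mul e g x : e != 0 ->
  valuation_ball (g + v (tofrac e)) (e * x) <-> valuation_ball g x.
Proof.
move=> e0; rewrite /valuation_ball; have [->|x0] := eqVneq x 0.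
  by rewrite mulr0; split=> _; left.
rewrite tofracM (Defs.valM valv) ?tofrac_neq0 // addrC ltD2l.
split=> -[x0'|]; [left|by right|by rewrite x0' eqxx in x0|by right].
by move/eqP: x0'; rewrite mulf_eq0 (negPf e0) => /eqP.
Qed.

Lemma max_idealE x : max_ideal x <-> valuation_ball 0 x.
Proof.
have [->|x0] := eqVneq x 0; first by rewrite /max_ideal /= unitr0; split=> // _; left.
split=> [mx|[x0'|vx]]; last 2 first.
- by rewrite x0' eqxx in x0.
- rewrite /max_ideal /=; apply/negP => xu; move: vx.
  rewrite -(ltD2l (- v (tofrac x))) addr0 addNr => vx.
  have xV0 : x^-1 != 0 by rewrite invr_eq0.
  have := vge0 xV0; rewrite leNgt => /negP; apply.
  have -> : v (tofrac x^-1) = - v (tofrac x) => //.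
  rewrite -vV ?tofrac_neq0 //; congr v; apply: (mulfI (tofrac_neq0 x0)).
  by rewrite -tofracM divrr // divff ?tofrac_neq0 // tofrac1.
right; rewrite lt_neqAle vge0 // andbT; apply/negP => /eqP vx0.
have [] := @dvd_of_le x 1 x0 (oner_neq0 R); first by rewrite tofrac1 v1 vx0.
move=> y [yx _]; move: mx; rewrite /max_ideal /= => /negP; apply.
by apply/unitrP; exists y; rewrite -yx mulrC -yx.
Qed.

Lemma cm_ball (c x : R) : c != 0 ->
  [set c * y | y in @max_ideal R] x <-> valuation_ball (v (tofrac c)) x.
Proof.
move=> c0; split=> [[y my <-]|].
  by rewrite -[v _]add0r; apply/(valuation_ball_mul _ _ c0)/max_idealE.
have [->|x0] := eqVneq x 0.
  by move=> _; exists 0; rewrite ?mulr0 // /max_ideal /= unitr0.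
case=> [x0'|cx]; first by rewrite x0' eqxx in x0.
have [y [xE vy]] := dvd_of_le c0 x0 (ltW cx).
exists y; last by rewrite mulrC.
apply/max_idealE; right; rewrite vy -(ltD2l (v (tofrac c))) addr0.
by rewrite addrC subrK.
Qed.
End valuation_balls.

(** * The implicit function *)

Section implicit_function.
Variables (R : idomainType) (r k : nat) (p : 'I_k -> mpoly (r + k) R).

Let J : 'M[R]_k := \matrix_(i, j) meval (fun=> 0) (mderiv (rshift r j) (p i)).
Let e : R := \det J.
Hypotheses (henR : henselian R) (dvdR : divisibility_total R).
Hypothesis p0 : forall i, meval (fun=> 0) (p i) = 0.

(** Only the last k variables move along adj(J); the first r are shifted by
    u = e^2 u'. *)
Lemma implicit_function_exists (u : 'rV[R]_r) : cm_pow (e ^+ 2) r u ->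
  exists y, cm_pow e k y /\ zero_locus p (row_mx u y).
Proof.
move=> um; have [locR _] := henR; have idm := max_ideal_is_ideal locR.
have /choice[u' u'P] : forall a, exists x, max_ideal x /\ e ^+ 2 * x = u 0 a.
  by move=> a; have [x mx xE] := um a; exists x.
pose U (l : 'I_(r + k)) := if fintype.split l is inl a then u' a else 0.
pose C (l : 'I_(r + k)) (j : 'I_k) := if fintype.split l is inr b then (\adj J) b j else 0.
have Ul a : U (lshift k a) = u' a by rewrite /U (unsplitK (inl _ a)).
have Ur b : U (rshift r b) = 0 by rewrite /U (unsplitK (inr _ b)).
have Cl a j : C (lshift k a) j = 0 by rewrite /C (unsplitK (inl _ a)).
have Cr b j : C (rshift r b) j = (\adj J) b j by rewrite /C (unsplitK (inr _ b)).
have [||||F [F0 dF FE]] := @jacobian_rescaling R (@max_ideal R) (r + k) k p (fun=> 0) U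
  (fun=> 0) e C idm.
- by move=> i; rewrite p0 mulr0.
- by move=> i; apply: (ideal0 idm).
- move=> l; rewrite /U; case: (fintype.split l) => [a|_]; last exact: (ideal0 idm).
  by case: (u'P a).
- move=> i j; rewrite big_split_ord /= big1 ?add0r => [|a _]; last by rewrite Cl mulr0.
  transitivity ((J *m \adj J) i j); last by rewrite mul_mx_adj mxE mulr_natr.
  by rewrite mxE; apply: eq_bigr => b _; rewrite Cr [J i b]mxE.
have [w wP] := multivariate_hensel henR dvdR F0 dF.
exists (\row_l (e * \sum_j (\adj J) l j * w j)); split=> [l|i].
  exists (\sum_j (\adj J) l j * w j); last by rewrite mxE.
  by apply: ideal_sum => // j _; apply: (idealM idm); case: (wP j).
have [_ wF] := wP i.
transitivity (e ^+ 2 * (w i - meval w (F i))); last by rewrite -wF subrr mulr0.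
rewrite -FE; apply: meval_eq => l; rewrite add0r; case: (split_ordP l) => [a ->|b ->].
  rewrite row_mxEl Ul; have [_ ->] := u'P a.
  by rewrite big1 ?mulr0 ?addr0 // => j _; rewrite Cl mul0r.
rewrite row_mxEr mxE Ur mulr0 add0r; congr (_ * _).
by apply: eq_bigr => j _; rewrite Cr.
Qed.

Let E x := exists2 y, max_ideal y & e * y = x.

Let E_ideal : local_ring R -> is_ideal E.
Proof.
move=> locR; have idm := max_ideal_is_ideal locR.
split=> [|_ _ [x mx <-] [y my <-]|a _ [x mx <-]].
- by exists 0; [apply: (ideal0 idm)|rewrite mulr0].
- by exists (x + y); [apply: (idealD idm)|rewrite mulrDr].
- by exists (a * x); [apply: (idealM idm)|rewrite mulrCA].
Qed.

Lemma meval_ideal (I : R -> Prop) n (f : mpoly n R) (x : 'I_n -> R) : is_ideal I ->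
  (forall i, I (x i)) -> I (meval x f - meval (fun=> 0) f).
Proof.
move=> idI Ix; have [N [fE _]] := taylor0 f.
rewrite [X in X - _](congr1 (meval x) fE) mevalD mevalC addrC addKr raddf_sum.
by apply: ideal_sum => // l _ /=; rewrite mevalM mevalXU; apply: idealMr.
Qed.

(** The first-order part of p(u, y) - p(u', y') in y - y' has a matrix of the
    form J + e M with M over the maximal ideal, and adj(J) (J + e M) is e times
    the invertible matrix 1 + adj(J) M. *)
Lemma implicit_function_lipschitz (u u' : 'rV[R]_r) (y y' : 'rV[R]_k) :
  cm_pow (e ^+ 2) r u -> cm_pow (e ^+ 2) r u' -> cm_pow e k y -> cm_pow e k y' ->
  zero_locus p (row_mx u y) -> zero_locus p (row_mx u' y') ->
  exists Q : 'M[R]_(k, r), e *: (y - y')^T = Q *m (u - u')^T.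
Proof.
move=> um um' ym ym' Z Z'; have [locR _] := henR.
have idm := max_ideal_is_ideal locR; have idE := E_ideal locR.
have cmE w z l : cm_pow (e ^+ 2) r w -> cm_pow e k z -> E ((row_mx w z) 0 l).
  move=> wm zm; case: (split_ordP l) => [a ->|b ->].
    rewrite row_mxEl; have [x mx <-] := wm a.
    by exists (e * x); [apply: (idealM idm)|rewrite mulrA].
  by rewrite row_mxEr; have [x mx <-] := zm b; exists x.
pose x l := (row_mx u y) 0 l; pose x' l := (row_mx u' y') 0 l; pose h l := x l - x' l.
have Eh l : E (h l) by apply: idealB => //; apply: cmE.
have /choice[s sE] : forall i, exists s : 'I_(r + k) -> 'I_(r + k) -> R,
    0 = \sum_l h l * (meval x' (mderiv l (p i)) + \sum_j h j * s l j).
  move=> i; have [//|//|//|s [_]] := @taylor R R idfun _ _ x' h (p i) (subringT R).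
  rewrite (@eq_mmap _ _ _ idfun _ x) => [|l]; last by rewrite /h addrC subrK.
  rewrite -/(meval x (p i)) -/(meval x' (p i)) Z Z' add0r => sE; exists s.
  rewrite {1}sE -big_split; apply: eq_bigr => l _ /=; rewrite mulrDr; congr (_ + _).
  by rewrite mulr_sumr; apply: eq_bigr => j _; rewrite mulrA.
pose T i l := meval x' (mderiv l (p i)) + \sum_j h j * s i l j.
have /choice[m mP] : forall il : 'I_k * 'I_k, exists m, max_ideal m /\
    e * m = T il.1 (rshift r il.2) - J il.1 il.2.
  move=> [i l] /=; suff [m mm mE] : E (T i (rshift r l) - J i l) by exists m.
  rewrite /T mxE addrAC; apply: (idealD idE).
    by apply: meval_ideal => // j; apply: cmE.
  by apply: ideal_sum => // j _; apply: idealMr.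
pose TL : 'M[R]_(k, r) := \matrix_(i, a) T i (lshift k a).
pose M : 'M[R]_k := \matrix_(i, l) m (i, l).
have main : (J + e *: M) *m (y - y')^T = - (TL *m (u - u')^T).
  apply/matrixP => i j; rewrite ord1 [RHS]mxE; apply/eqP; rewrite -addr_eq0; apply/eqP.
  rewrite !mxE [RHS](sE i) big_split_ord /= [RHS]addrC; congr (_ + _); last first.
    by apply: eq_bigr => a _; rewrite !mxE /h /x /x' !row_mxEl mulrC.
  apply: eq_bigr => b _; rewrite !mxE [h _]/(x _ - x' _) /x /x' !row_mxEr [RHS]mulrC.
  by congr (_ * _); have [_ ->] := mP (i, b); rewrite mxE /= addrC subrK.
pose L := 1%:M + \adj J *m M.
have Lu : \det L \is a GRing.unit.
  apply: (det_unit locR (unitr1 R)) => i j; rewrite !mxE addrAC subrr add0r.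
  apply: ideal_sum => // l _; apply: (idealM idm); rewrite mxE.
  by case: (mP (l, j)).
exists (- (invmx L *m \adj J *m TL)).
rewrite mulNmx -!mulmxA -mulmxN -mulmxN -main !mulmxA.
have -> : invmx L *m \adj J *m (J + e *: M) = e%:M.
  rewrite -mulmxA mulmxDr mul_adj_mx -scalemxAr -/e.
  by rewrite -[e%:M]scalemx1 -scalerDr -scalemxAr mulVmx.
by rewrite mul_scalar_mx.
Qed.
End implicit_function.

(** * Continuity *)

Lemma continuous_into_subtype (X Y : topologicalType) (A : set Y) (f : X -> A) :
  continuous (fun x => set_val (f x)) -> continuous f.
Proof. exact: (@continuous_comp_initial A X Y set_val f). Qed.

Lemma continuous_set_val (Y : topologicalType) (A : set Y) :
  continuous (set_val : A -> Y).
Proof. exact: initial_continuous. Qed.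

Lemma continuous_entries (X T : topologicalType) m n (f : X -> 'M[T]_(m, n)) :
  (forall i j, continuous (fun x => f x i j)) -> continuous f.
Proof.
move=> fc x U [P PU sPU]; apply: filterS (sPU) _.
apply: filter_forall => i; apply: filter_forall => j.
by apply: fc; apply: PU.
Qed.

Lemma continuous_entry (T : topologicalType) m n (i : 'I_m) (j : 'I_n) :
  continuous (fun M : 'M[T]_(m, n) => M i j).
Proof.
move=> M U MU; exists (fun i' j' => [set t | i' = i -> j' = j -> U t]).
  move=> i' j'; have [->|ni] := pselect (i' = i); last by apply: filterS filterT => t _ /ni.
  have [->|nj] := pselect (j' = j); last by apply: filterS filterT => t _ _ /nj.
  by apply: filterS MU => t Ut _ _.
by move=> N NP /=; apply: NP.
Qed.

Section balls_are_neighborhoods.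
Variables (R : topIdomainType) (G : porderZmodType) (v : {fraction R} -> G).
Hypotheses (vR : valuation_ring v) (vtop : valuation_topology v).

Lemma nbhs_ball (a : R) (g : G) : nbhs a [set b | valuation_ball v g (b - a)].
Proof.
apply/vtop; exists g => b [->|gb]; first by left; rewrite subrr.
by right.
Qed.

Lemma ball_nbhs (a : R) (U : set R) : nbhs a U ->
  exists g, [set b | valuation_ball v g (b - a)] `<=` U.
Proof.
case/vtop=> g sU; exists g => b [/eqP|gb]; last by apply: sU; right.
by rewrite subr_eq0 => /eqP ->; apply: sU; left.
Qed.

Lemma nbhs_row n (x : 'rV[R]_n) (g : 'I_n -> G) :
  nbhs x [set y | forall i, valuation_ball v (g i) (y 0 i - x 0 i)].
Proof.
exists (fun i j => [set b | valuation_ball v (g j) (b - x i j)]).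
  by move=> i j; exact: nbhs_ball.
by move=> y yP i /=; apply: yP.
Qed.

Lemma nbhs_cm_pow (c : R) n (x : 'rV[R]_n) : c != 0 -> cm_pow c n x ->
  nbhs x (cm_pow c n).
Proof.
move=> c0 cx; apply: filterS (nbhs_row x (fun=> v (tofrac c))) => y yP i.
apply/(cm_ball vR) => //; rewrite -[y 0 i](subrK (x 0 i)).
apply: (idealD (valuation_ball_is_ideal vR _)); first exact: yP.
by apply/(cm_ball vR) => //; exact: cx.
Qed.
End balls_are_neighborhoods.

Theorem proposition5 (R : topIdomainType) (G : porderZmodType)
    (v : {fraction R} -> G) (hR : henselian_valued_ring v)
    (r k : nat) (hk : (0 < k)%N) (p : 'I_k -> {mpoly R[r + k]}) (e : R)
    (he : e = meval (fun=> 0) (jacobian p))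
    (h0 : zero_locus p 0) (e0 : e != 0) :
  exists phi : cm_pow (e ^+ 2) r -> cm_pow e k,
    [/\ continuous phi,
        forall u, set_val u = 0 -> set_val (phi u) = 0 &
        exists graph : cm_pow (e ^+ 2) r -> zero_locus p,
          (forall u, set_val (graph u) =
             row_mx (set_val u) (set_val (phi u))) /\
          open_embedding graph].
Proof.
have [vR henR vtop] := hR; have dvdR := valuation_ring_divisibility vR.
have p0 i : meval (fun=> 0) (p i) = 0.
  by rewrite -[RHS](h0 i); apply: meval_eq => l; rewrite mxE.
have eE : e = \det (\matrix_(i, j) meval (fun=> 0) (mderiv (rshift r j) (p i))).
  by rewrite he /jacobian -det_map_mx; congr (\det _); apply/matrixP => i j; rewrite !mxE.
have exy (u : cm_pow (e ^+ 2) r) : exists y : cm_pow e k,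
    zero_locus p (row_mx (set_val u) (set_val y)).
  have := set_valP u; rewrite set_valE {1}eE => um.
  have [y []] := implicit_function_exists henR dvdR p0 um.
  rewrite -eE => ym yZ; by exists (SigSub (mem_set ym)).
have /choice[phi phiP] := exy.
have e20 : e ^+ 2 != 0 by rewrite expf_neq0.
have lip (u u' : 'rV[R]_r) (y y' : 'rV[R]_k) :
    cm_pow (e ^+ 2) r u -> cm_pow (e ^+ 2) r u' -> cm_pow e k y -> cm_pow e k y' ->
    zero_locus p (row_mx u y) -> zero_locus p (row_mx u' y') ->
    exists Q : 'M[R]_(k, r), e *: (y - y')^T = Q *m (u - u')^T.
  by rewrite eE => *; apply: (implicit_function_lipschitz henR).
have uniq (u : 'rV[R]_r) (y y' : 'rV[R]_k) :
    cm_pow (e ^+ 2) r u -> cm_pow e k y -> cm_pow e k y' ->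
    zero_locus p (row_mx u y) -> zero_locus p (row_mx u y') -> y = y'.
  move=> um ym ym' Z Z'; have [Q] := lip _ _ _ _ um um ym ym' Z Z'.
  rewrite subrr trmx0 mulmx0 => /matrixP yy'; apply/rowP => l.
  have /eqP := yy' l 0; rewrite !mxE mulf_eq0 (negPf e0) subr_eq0 => /eqP //.
have phi_cont : continuous phi.
  apply: continuous_into_subtype; apply: continuous_entries => i j u U.
  rewrite ord1 => /(ball_nbhs vtop)[g gU].
  (* The loss of v(e) comes from the factor e in the Lipschitz estimate. *)
have cu : nbhs u (set_val @^-1`
      [set w : 'rV[R]_r | forall a, valuation_ball v (g + v (tofrac e)) (w 0 a - set_val u 0 a)]).
    by apply: continuous_set_val; apply: (nbhs_row vtop).
  apply: filterS cu => u' u'P /=; apply: gU => /=.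
  apply/(valuation_ball_mul vR _ _ e0).
  have [Q /matrixP/(_ j 0)] := lip _ _ _ _ (set_valP u') (set_valP u)
    (set_valP (phi u')) (set_valP (phi u)) (phiP u') (phiP u).
  rewrite !mxE => ->; apply: ideal_sum => [|a _]; first exact: valuation_ball_is_ideal.
  by rewrite !mxE; apply: (idealM (valuation_ball_is_ideal vR _)); apply: u'P.
exists phi; split=> //.
  move=> u u0; apply: (uniq (set_val u)) (phiP u) _.
  - exact: set_valP.
  - exact: set_valP.
  - by move=> i; exists 0; rewrite ?mulr0 ?mxE // /max_ideal /= unitr0.
  - by rewrite u0 row_mx0.
pose graph u : zero_locus p := SigSub (mem_set (phiP u)).
have graph_cont : continuous graph.
  apply: continuous_into_subtype; apply: continuous_entries => i j.
  rewrite ord1; case: (split_ordP j) => [a ->|b ->] u.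
    under eq_fun do rewrite /= row_mxEl.
    apply: (@continuous_comp _ _ _ set_val (fun x : 'rV[R]_r => x 0 a)).
      exact: continuous_set_val.
    exact: continuous_entry.
  under eq_fun do rewrite /= row_mxEr.
  apply: (@continuous_comp _ _ _ (fun u => set_val (phi u)) (fun x : 'rV[R]_k => x 0 b)).
    by apply: continuous_comp; [exact: phi_cont|exact: continuous_set_val].
  exact: continuous_entry.
exists graph; split=> //.
pose W : set (zero_locus p) := [set x | cm_pow (e ^+ 2) r (lsubmx (set_val x)) /\
  cm_pow e k (rsubmx (set_val x))].
have lsub_cont : continuous (@lsubmx R 1 r k).
  apply: continuous_entries => i j; under eq_fun do rewrite mxE.
  exact: continuous_entry.
have rsub_cont : continuous (@rsubmx R 1 r k).
  apply: continuous_entries => i j; under eq_fun do rewrite mxE.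
  exact: continuous_entry.
have cl : continuous (fun x : zero_locus p => lsubmx (set_val x)).
  move=> x; apply: (@continuous_comp _ _ _ set_val (@lsubmx R 1 r k)).
    exact: continuous_set_val.
  exact: lsub_cont.
have cr : continuous (fun x : zero_locus p => rsubmx (set_val x)).
  move=> x; apply: (@continuous_comp _ _ _ set_val (@rsubmx R 1 r k)).
    exact: continuous_set_val.
  exact: rsub_cont.
(* By uniqueness the part W of V in the box is the graph of phi. *)
have oW : open W.
  rewrite openE => x [xl xr]; rewrite /interior.
  have nl : nbhs x [set x' | cm_pow (e ^+ 2) r (lsubmx (set_val x'))] :=
    cl x _ (nbhs_cm_pow vR vtop e20 xl).
  have nr : nbhs x [set x' | cm_pow e k (rsubmx (set_val x'))] :=
    cr x _ (nbhs_cm_pow vR vtop e0 xr).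
  exact: filterI nl nr.
exists W => //.
have graphW u : W (graph u).
  by rewrite /W /= row_mxKl row_mxKr; split; exact: set_valP.
pose h u : W := SigSub (mem_set (graphW u)).
pose g (x : W) : cm_pow (e ^+ 2) r := SigSub (mem_set (set_valP x).1).
exists h; split=> //; exists g; split.
- by apply: continuous_into_subtype; exact: graph_cont.
- apply: continuous_into_subtype => x.
  apply: (@continuous_comp _ _ _ set_val
    (fun x : zero_locus p => lsubmx (set_val x))); last exact: cl.
  exact: continuous_set_val.
- by move=> u; apply: val_inj; rewrite /= row_mxKl.
- move=> x; apply/val_inj/val_inj => /=.
  rewrite -[RHS]hsubmxK; congr row_mx.
  have [xl xr] := set_valP x.
  apply: (uniq _ _ _ xl _ xr (phiP (g x))); first exact: set_valP.
  by rewrite hsubmxK; apply: set_valP.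
Qed.
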